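(* Let $k_0$ be any field. The algebra of operations $K^{M}_i(k)/2 \to K^{M}_*(k)/2$ commuting with field extensions over $k_0$ is: \begin{itemize} \item if $i=0$, the free $K^{M}_*(k_0)/2$-module of rank $2$ of functions $\mathbf{F}_2\to K^{M}_*(k_0)/2$; \item if $i=1$, the free $K^{M}_*(k_0)/2$-module of rank $2$ generated by $\gamma_0$ and $\gamma_1$; \item if $i\geq 2$, the $K^{M}_*(k_0)/2$-module $$K^{M}_*(k_0)/2\cdot\gamma_0\oplus K^{M}_*(k_0)/2\cdot\gamma_1\oplus\bigoplus_{n\geq 2}\mathrm{Ker}(\tau_i)\cdot\gamma_n,$$ where $\tau_i:K^{M}_*(k_0)/2\to K^{M}_*(k_0)/2$ is the map $x\mapsto\{-1\}^{i-1}\cdot x$. \end{itemize}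
   Context: For a field $k$, $K^M_n(k)$ is the Milnor $K$-group: the quotient of $(k^\times)^{\otimes n}$ by the relations $a_1\otimes\cdots\otimes a_n=0$ whenever $a_r+a_s=1$ for some $r<s$; the image of $a_1\otimes\cdots\otimes a_n$ is denoted $\{a_1,\ldots,a_n\}$ and called a symbol. $K^M_0(k)=\mathbf{Z}$, and $K^M_*(k)=\bigoplus_{n\ge0}K^M_n(k)$ is a graded ring under the product induced by concatenation. $K^M_n(k)/2$ is the quotient by $2$. An operation $K^M_i/2\to K^M_*/2$ over $k_0$ is a natural transformation from the functor $K^M_i/2$ from field extensions of $k_0$ to sets, to the functor $K^M_*/2$ from field extensions of $k_0$ to $\mathbf{F}_2$-algebras; that is, a family of functions (not assumed additive) $\varphi:K^M_i(k)/2\to K^M_*(k)/2$, one for each extension $k/k_0$, compatible with the maps induced by extensions of fields $k\subset l$ over $k_0$. Operations are added and multiplied pointwise, and form a module over $K^M_*(k_0)/2$ via $(a\cdot\varphi)(x)=a_k\cdot\varphi(x)$ for $x\in K^M_i(k)/2$, where $a_k$ is the image of $a$ in $K^M_*(k)/2$. A function $f:\mathbf{F}_2\to K^M_*(k_0)/2$ gives the operation $x\mapsto f(x)$ on $K^M_0(k)/2=\mathbf{F}_2$. Divided powers: for $x=s_1+\cdots+s_l$ a sum of symbols in $K^M_i(k)/2$, put $\gamma_n(x)=\sum_{1\le l_1<\cdots<l_n\le l}s_{l_1}\cdots s_{l_n}$; $\gamma_0=1$ and $\gamma_1=\mathrm{id}$. In general $\gamma_n(x)$ may depend on the decomposition of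 $x$, but for $i\ge 2$ and $y_n\in\mathrm{Ker}(\tau_i)$ the element $(y_n\cdot\gamma_n)(x)=y_n\cdot\sum_{l_1<\cdots<l_n}s_{l_1}\cdots s_{l_n}$ does not, and $\mathrm{Ker}(\tau_i)\cdot\gamma_n$ denotes the set of these operations $y_n\cdot\gamma_n$.
   Formalization: For i ≥ 2 the direct sum describes only the operations of bounded degree; all operations form the direct product (sums of y_n·γ_n, possibly infinite but finite at each x), since e.g. over C with i = 2 the sum of all γ_n is an operation outside the direct sum. *)

(* Defs.v *)
From HB Require Import structures.
From mathcomp Require Import all_boot all_order all_algebra.
From mathcomp Require Import finmap monalg boolp.

Set Implicit Arguments.
Unset Strict Implicit.
Unset Printing Implicit Defensive.

Import GRing.Theory.
Local Open Scope quotient_scope.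
Local Open Scope ring_scope.

(* The quotient of a ring by the two-sided ideal generated by G; the library
   only has quotients of commutative rings. *)
Section GeneratedIdeal.
Variables (R : pzRingType) (G : R -> Prop).

Inductive ideal_gen : R -> Prop :=
| ideal_gen0 : ideal_gen 0
| ideal_genB x y : ideal_gen x -> ideal_gen y -> ideal_gen (x - y)
| ideal_genG a g b : G g -> ideal_gen (a * g * b).

Definition in_ideal : {pred R} := fun x => `[< ideal_gen x >].

Lemma in_idealP x : reflect (ideal_gen x) (x \in in_ideal).
Proof. exact: asboolP. Qed.

Lemma in_ideal_zmod : zmod_closed in_ideal.
Proof.
split=> [|x y /in_idealP xI /in_idealP yI]; apply/in_idealP.
  exact: ideal_gen0.
exact: ideal_genB.
Qed.

HB.instance Definition _ := GRing.isZmodClosed.Build R in_ideal in_ideal_zmod.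

Lemma in_idealMl a x : x \in in_ideal -> a * x \in in_ideal.
Proof.
move=> /in_idealP xI; apply/in_idealP; elim: xI => [|u v _ IHu _ IHv|b g c gG].
- by rewrite mulr0; exact: ideal_gen0.
- by rewrite mulrBr; exact: ideal_genB.
- by rewrite !mulrA; exact: ideal_genG.
Qed.

Lemma in_idealMr a x : x \in in_ideal -> x * a \in in_ideal.
Proof.
move=> /in_idealP xI; apply/in_idealP; elim: xI => [|u v _ IHu _ IHv|b g c gG].
- by rewrite mul0r; exact: ideal_gen0.
- by rewrite mulrBl; exact: ideal_genB.
- by rewrite -mulrA; exact: ideal_genG.
Qed.

Definition ringquot := Quotient.quot in_ideal.

HB.instance Definition _ := Choice.on ringquot.

(* The operations, and word below, are locked: unfolding them makes failing
   unifications very slow. *)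
Fact ringquot_key : unit. Proof. by []. Qed.

Definition ringquot_proj : R -> ringquot :=
  locked_with ringquot_key (\pi_(Quotient.quot in_ideal)).
Definition ringquot_opp : ringquot -> ringquot :=
  locked_with ringquot_key (@GRing.opp (Quotient.quot in_ideal)).
Definition ringquot_add : ringquot -> ringquot -> ringquot :=
  locked_with ringquot_key (@GRing.add (Quotient.quot in_ideal)).
Definition ringquot_mul : ringquot -> ringquot -> ringquot :=
  locked_with ringquot_key
    (fun x y : Quotient.quot in_ideal => ringquot_proj (repr x * repr y)).

Lemma ringquot_addA : associative ringquot_add.
Proof. by rewrite /ringquot_add !locked_withE; exact: (@addrA (Quotient.quot in_ideal)). Qed.
Lemma ringquot_addC : commutative ringquot_add.
Proof. by rewrite /ringquot_add !locked_withE; exact: (@addrC (Quotient.quot in_ideal)). Qed.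
Lemma ringquot_add0 : left_id (ringquot_proj 0) ringquot_add.
Proof.
rewrite /ringquot_add /ringquot_proj !locked_withE => x.
by rewrite (raddf0 \pi_(Quotient.quot in_ideal)); exact: (@add0r (Quotient.quot in_ideal)).
Qed.
Lemma ringquot_addN : left_inverse (ringquot_proj 0) ringquot_opp ringquot_add.
Proof.
rewrite /ringquot_add /ringquot_opp /ringquot_proj !locked_withE => x.
by rewrite (raddf0 \pi_(Quotient.quot in_ideal)); exact: (@addNr (Quotient.quot in_ideal)).
Qed.

HB.instance Definition _ := GRing.isZmodule.Build ringquot
  ringquot_addA ringquot_addC ringquot_add0 ringquot_addN.

Definition ringquot_repr (x : ringquot) : R := repr (x : Quotient.quot in_ideal).

Lemma ringquot_projE x y :
  (ringquot_proj x == ringquot_proj y) = (x - y \in in_ideal).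
Proof. by rewrite /ringquot_proj !locked_withE Quotient.idealrBE. Qed.

Lemma ringquot_reprK : cancel ringquot_repr ringquot_proj.
Proof. by move=> x; rewrite /ringquot_proj !locked_withE; exact: reprK. Qed.

Lemma ringquot_proj_zmod : zmod_morphism ringquot_proj.
Proof.
move=> x y; rewrite -[RHS]/(ringquot_add _ (ringquot_opp _)).
rewrite /ringquot_add /ringquot_opp /ringquot_proj !locked_withE.
exact: pi_is_zmod_morphism.
Qed.

Definition ringquot_one := ringquot_proj 1.

Lemma ringquot_projM x y :
  ringquot_proj (x * y) = ringquot_mul (ringquot_proj x) (ringquot_proj y).
Proof.
rewrite /ringquot_mul locked_withE; apply/eqP; rewrite ringquot_projE.
rewrite -!/(ringquot_repr _).
set x' := ringquot_repr _; set y' := ringquot_repr _.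
have xI : x - x' \in in_ideal by rewrite -ringquot_projE ringquot_reprK.
have yI : y - y' \in in_ideal by rewrite -ringquot_projE ringquot_reprK.
have -> : x * y - x' * y' = (x - x') * y + x' * (y - y').
  by rewrite mulrBl mulrBr addrA subrK.
by apply: rpredD; [exact: in_idealMr | exact: in_idealMl].
Qed.

Let ind (P : ringquot -> Prop) : (forall x, P (ringquot_proj x)) -> forall x, P x.
Proof. by move=> H x; rewrite -(ringquot_reprK x); exact: H. Qed.

Let projD x y : ringquot_proj (x + y) = ringquot_proj x + ringquot_proj y.
Proof.
have p0 : ringquot_proj 0 = 0 by rewrite -(subrr 0) ringquot_proj_zmod subrr.
by rewrite -{1}[y]opprK -(sub0r y) ringquot_proj_zmod ringquot_proj_zmod p0 sub0r opprK.
Qed.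

Lemma ringquot_mulA : associative ringquot_mul.
Proof.
apply: ind => x; apply: ind => y; apply: ind => z.
by rewrite -!ringquot_projM mulrA.
Qed.
Lemma ringquot_mul1 : left_id ringquot_one ringquot_mul.
Proof. by apply: ind => x; rewrite -!ringquot_projM mul1r. Qed.
Lemma ringquot_mulr1 : right_id ringquot_one ringquot_mul.
Proof. by apply: ind => x; rewrite -!ringquot_projM mulr1. Qed.
Lemma ringquot_mulDl : left_distributive ringquot_mul +%R.
Proof.
apply: ind => x; apply: ind => y; apply: ind => z.
by rewrite -projD -!ringquot_projM -projD mulrDl.
Qed.
Lemma ringquot_mulDr : right_distributive ringquot_mul +%R.
Proof.
apply: ind => x; apply: ind => y; apply: ind => z.
by rewrite -projD -!ringquot_projM -projD mulrDr.
Qed.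

HB.instance Definition _ := GRing.Zmodule_isPzRing.Build ringquot
  ringquot_mulA ringquot_mul1 ringquot_mulr1 ringquot_mulDl ringquot_mulDr.

HB.instance Definition _ :=
  GRing.isZmodMorphism.Build R ringquot ringquot_proj ringquot_proj_zmod.

Lemma ringquot_proj_monoid : monoid_morphism ringquot_proj.
Proof. by split=> // x y; rewrite ringquot_projM. Qed.

HB.instance Definition _ :=
  GRing.isMonoidMorphism.Build R ringquot ringquot_proj ringquot_proj_monoid.

Lemma ringquot_proj_gen g : G g -> ringquot_proj g = 0.
Proof.
move=> gG; apply/eqP; rewrite -(rmorph0 ringquot_proj) ringquot_projE subr0.
by apply/in_idealP; rewrite -(mul1r g) -(mulr1 (1 * g)); exact: ideal_genG.
Qed.

Section Lift.
Variables (S : pzRingType) (h : {rmorphism R -> S}).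
Hypothesis hG : forall g, G g -> h g = 0.

Definition ringquot_lift of (forall g, G g -> h g = 0) :=
  fun x : ringquot => h (ringquot_repr x).

Let hI x : x \in in_ideal -> h x = 0.
Proof.
move=> /in_idealP; elim=> [|u v _ IHu _ IHv|a g b gG].
- exact: rmorph0.
- by rewrite rmorphB IHu IHv subrr.
- by rewrite !rmorphM (hG gG) mulr0 mul0r.
Qed.

Lemma ringquot_liftE x : ringquot_lift hG (ringquot_proj x) = h x.
Proof.
apply/eqP; rewrite -subr_eq0 -rmorphB hI //.
by rewrite -ringquot_projE ringquot_reprK.
Qed.

Lemma ringquot_lift_zmod : zmod_morphism (ringquot_lift hG).
Proof.
by apply: ind => x; apply: ind => y; rewrite -rmorphB !ringquot_liftE rmorphB.
Qed.

Lemma ringquot_lift_monoid : monoid_morphism (ringquot_lift hG).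
Proof.
split; first by rewrite -(rmorph1 ringquot_proj) ringquot_liftE rmorph1.
by apply: ind => x; apply: ind => y; rewrite -rmorphM !ringquot_liftE rmorphM.
Qed.

HB.instance Definition _ := GRing.isZmodMorphism.Build ringquot S
  (ringquot_lift hG) ringquot_lift_zmod.
HB.instance Definition _ := GRing.isMonoidMorphism.Build ringquot S
  (ringquot_lift hG) ringquot_lift_monoid.

End Lift.
End GeneratedIdeal.

Definition kunits (k : fieldType) := {a : k | a != 0}.

Definition kunits_map (k l : fieldType) (f : {rmorphism k -> l}) (a : kunits k) :
    kunits l :=
  exist _ (f (val a)) (etrans (congr1 negb (fmorph_eq0 f (val a))) (valP a)).

Definition kunits_N1 (k : fieldType) : kunits k :=
  exist _ (-1) (etrans (congr1 negb (oppr_eq0 1)) (oner_neq0 k)).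

(* Z<k^x>, graded by word length: its part of degree n is the free abelian
   group on the n-tuples of units of k. *)
Notation free_ring k := {malg int[{fmonom (kunits k)}]}.

Fact word_key : unit. Proof. by []. Qed.
Definition word (k : fieldType) : seq (kunits k) -> free_ring k :=
  locked_with word_key (fun w => << 1 *g FMonom w >>).

Lemma wordE (k : fieldType) (w : seq (kunits k)) : word w = << 1 *g FMonom w >>.
Proof. by rewrite /word locked_withE. Qed.

Section FreeRingTheory.
Variable k : fieldType.

Lemma word_cat (w1 w2 : seq (kunits k)) : word (w1 ++ w2) = word w1 * word w2.
Proof.
by rewrite !wordE malgM_def fgmulUU mulr1 /mul /= fmmulE.
Qed.

Lemma word_nil : word [::] = 1 :> free_ring k.
Proof. by rewrite wordE -fmoneE. Qed.

Lemma free_ringE (x : free_ring k) :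
  x = \sum_(m <- msupp x) (x@_m)%:~R * word (fmonom_val m).
Proof.
rewrite {1}[x]monalgE; apply: eq_bigr => m _.
by rewrite mulrzl wordE -raddfMz /= intz; case: m.
Qed.

Variables (S : nzRingType) (h : kunits k -> S).

Definition word_eval (m : {fmonom (kunits k)}) : S := \prod_(a <- fmonom_val m) h a.

Lemma word_eval_mmorphism : mmorphism word_eval.
Proof.
split=> [x y|]; first by rewrite /word_eval -big_cat /= -fmM.
by rewrite /word_eval fm1 big_nil.
Qed.

HB.instance Definition _ :=
  isMultiplicative.Build {fmonom (kunits k)} S word_eval word_eval_mmorphism.

Definition free_lift : free_ring k -> S := mmap intr word_eval.

Lemma free_lift_zmod : zmod_morphism free_lift.
Proof. exact: mmap_is_additive. Qed.
Lemma free_lift_monoid : monoid_morphism free_lift.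
Proof.
have [|H1 H2] := @commr_mmap_is_multiplicative _ _ _ intr word_eval.
  by move=> g m m'; rewrite /= /GRing.comm mulrzr mulrzl.
by split.
Qed.

HB.instance Definition _ :=
  GRing.isZmodMorphism.Build (free_ring k) S free_lift free_lift_zmod.
HB.instance Definition _ :=
  GRing.isMonoidMorphism.Build (free_ring k) S free_lift free_lift_monoid.

Lemma free_liftE w : free_lift (word w) = \prod_(a <- w) h a.
Proof. by rewrite /free_lift wordE mmapU /= mul1r. Qed.

End FreeRingTheory.

(* The first relation turns Z<k^x> into the tensor algebra of the Z-module k^x.
   All relations are homogeneous, and a word containing a Steinberg word is
   again one, so in degree n the ideal they generate consists exactly of the
   multilinearity relations and the Steinberg relations on n-tuples: the part
   of degree n of milnorK k is K^M_n(k), and milnorK k is the direct sum. *)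
Inductive milnor_rel (k : fieldType) : free_ring k -> Prop :=
| milnor_rel_mul (a b c : kunits k) : val c = val a * val b ->
    milnor_rel (word [:: c] - (word [:: a] + word [:: b]))
| milnor_rel_steinberg n (w : n.-tuple (kunits k)) (r s : 'I_n) :
    (r < s)%N -> val (tnth w r) + val (tnth w s) = 1 -> milnor_rel (word w).

Definition milnorK (k : fieldType) := ringquot (@milnor_rel k).
HB.instance Definition _ k := GRing.PzRing.on (milnorK k).

Definition milnorK2 (k : fieldType) :=
  ringquot (fun x : milnorK k => x = 2%:R).
HB.instance Definition _ k := GRing.PzRing.on (milnorK2 k).

Definition to_milnorK (k : fieldType) : free_ring k -> milnorK k :=
  ringquot_proj (@milnor_rel k).
HB.instance Definition _ k :=
  GRing.RMorphism.copy (@to_milnorK k) (ringquot_proj (@milnor_rel k)).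

Definition mod2 (k : fieldType) : milnorK k -> milnorK2 k :=
  ringquot_proj (fun x : milnorK k => x = 2%:R).
HB.instance Definition _ k := GRing.RMorphism.copy (@mod2 k)
  (ringquot_proj (fun x : milnorK k => x = 2%:R)).

Lemma mod2_2 k : mod2 2%:R = 0 :> milnorK2 k.
Proof. exact: ringquot_proj_gen. Qed.

Definition symbol (k : fieldType) (w : seq (kunits k)) : milnorK2 k :=
  mod2 (to_milnorK (word w)).

Section Lifts.
Variables (k : fieldType) (S : pzRingType).

Lemma milnorK2_ind (P : milnorK2 k -> Prop) :
  (forall x : free_ring k, P (mod2 (to_milnorK x))) -> forall x, P x.
Proof.
move=> H x; rewrite -(ringquot_reprK x) -[ringquot_repr x]ringquot_reprK; exact: H.
Qed.

Lemma milnorK2_ext (g h : {rmorphism milnorK2 k -> S}) :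
  (forall w, g (symbol w) = h (symbol w)) -> g =1 h.
Proof.
move=> gh; apply: milnorK2_ind => x; rewrite [x]free_ringE !raddf_sum.
apply: eq_bigr => m _; rewrite mulrzl !raddfMz /=; congr (_ *~ _); exact: gh.
Qed.

Variable h : {rmorphism free_ring k -> S}.
Hypothesis h_rel : forall x, milnor_rel x -> h x = 0.
Hypothesis S2 : 2%:R = 0 :> S.

Definition milnorK_lift : milnorK k -> S := ringquot_lift h_rel.
HB.instance Definition _ := GRing.RMorphism.copy milnorK_lift (ringquot_lift h_rel).

Lemma milnorK_lift2 x : x = 2%:R -> milnorK_lift x = 0.
Proof. by move=> ->; rewrite rmorph_nat. Qed.

Definition milnorK2_lift : milnorK2 k -> S := ringquot_lift milnorK_lift2.
HB.instance Definition _ :=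
  GRing.RMorphism.copy milnorK2_lift (ringquot_lift milnorK_lift2).

Lemma milnorK2_liftE x : milnorK2_lift (mod2 (to_milnorK x)) = h x.
Proof. exact: etrans (ringquot_liftE milnorK_lift2 _) (ringquot_liftE h_rel _).
Qed.

End Lifts.

Lemma milnorK2_2 k : 2%:R = 0 :> milnorK2 k.
Proof. by rewrite -(mod2_2 k) rmorph_nat. Qed.

Section Functoriality.
Variables (k l : fieldType) (f : {rmorphism k -> l}).

Definition free_map : free_ring k -> free_ring l :=
  free_lift (fun a => word [:: kunits_map f a]).
HB.instance Definition _ := GRing.RMorphism.on free_map.

Lemma free_mapE w : free_map (word w) = word (map (kunits_map f) w).
Proof.
rewrite /free_map free_liftE; elim: w => [|a w IHw].
  by rewrite big_nil /= word_nil.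
by rewrite big_cons IHw -word_cat.
Qed.

Definition free_mapK2 : free_ring k -> milnorK2 l :=
  @mod2 l \o (@to_milnorK l \o free_map).
HB.instance Definition _ := GRing.RMorphism.on free_mapK2.

Lemma free_mapK2E w : free_mapK2 (word w) = symbol (map (kunits_map f) w).
Proof. by rewrite /free_mapK2 /= free_mapE. Qed.

Lemma free_mapK2_rel x : milnor_rel x -> free_mapK2 x = 0.
Proof.
move=> xR; rewrite /free_mapK2 /= [to_milnorK _]ringquot_proj_gen ?raddf0 //.
case: xR => {x} [a b c abc|n w r s rs ars].
  rewrite raddfB raddfD [X in milnor_rel (X - _)]free_mapE.
  rewrite [X in _ - (X + _)]free_mapE [X in _ - (_ + X)]free_mapE.
  by apply: milnor_rel_mul; rewrite /= abc rmorphM.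
rewrite free_mapE; apply: (milnor_rel_steinberg (w := map_tuple _ w) rs).
by rewrite !tnth_map /= -rmorphD ars rmorph1.
Qed.

Definition milnorK2_map : milnorK2 k -> milnorK2 l :=
  milnorK2_lift free_mapK2_rel (milnorK2_2 l).
HB.instance Definition _ := GRing.RMorphism.on milnorK2_map.

Lemma milnorK2_map_symbol w :
  milnorK2_map (symbol w) = symbol (map (kunits_map f) w).
Proof. exact: etrans (milnorK2_liftE _ _ _) (free_mapK2E w). Qed.

End Functoriality.

Lemma milnorK2_map_comp (k l m : fieldType) (f : {rmorphism k -> l})
    (g : {rmorphism l -> m}) (h : {rmorphism k -> m}) :
  (forall a, g (f a) = h a) ->
  forall x, milnorK2_map g (milnorK2_map f x) = milnorK2_map h x.
Proof.
move=> gfh; apply: (milnorK2_ext (g := milnorK2_map g \o milnorK2_map f)) => w /=.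
rewrite !milnorK2_map_symbol -map_comp; congr symbol; apply: eq_map => a.
by apply: val_inj; rewrite /= gfh.
Qed.

(* The component of degree 0, with K^M_0(k)/2 identified with 'F_2. *)
Section DegreeZero.
Variable k : fieldType.

Definition free_degree0 : free_ring k -> 'F_2 :=
  free_lift (fun _ : kunits k => 0).
HB.instance Definition _ := GRing.RMorphism.on free_degree0.

Lemma free_degree0E w : free_degree0 (word w) = (w == [::])%:R.
Proof.
rewrite /free_degree0 free_liftE.
by case: w => [|a w]; rewrite ?big_nil // big_cons mul0r.
Qed.

Lemma free_degree0_rel x : milnor_rel x -> free_degree0 x = 0.
Proof.
case=> [a b c _|n w r s _ _].
  rewrite raddfB raddfD [X in X - _ = _]free_degree0E.
  rewrite [X in _ - (X + _)]free_degree0E [X in _ - (_ + X)]free_degree0E.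
  exact: val_inj.
rewrite [LHS]free_degree0E -size_eq0 size_tuple.
by case: n w r s => [w []|] //.
Qed.

Lemma F2_2 : 2%:R = 0 :> 'F_2.
Proof. exact: val_inj. Qed.

Definition degree0 : milnorK2 k -> 'F_2 :=
  milnorK2_lift free_degree0_rel F2_2.
HB.instance Definition _ := GRing.RMorphism.on degree0.

Lemma degree0_symbol w : degree0 (symbol w) = (w == [::])%:R.
Proof.
exact: etrans (milnorK2_liftE _ _ _) (free_degree0E w).
Qed.

Lemma milnorK2_nonzero : 1 != 0 :> milnorK2 k.
Proof.
apply/eqP => /(congr1 degree0); rewrite rmorph1 rmorph0.
by move/eqP; rewrite oner_eq0.
Qed.
HB.instance Definition _ :=
  GRing.PzSemiRing_isNonZero.Build (milnorK2 k) milnorK2_nonzero.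
End DegreeZero.

Lemma degree0_map (k l : fieldType) (f : {rmorphism k -> l}) x :
  degree0 (milnorK2_map f x) = degree0 x.
Proof.
apply: (milnorK2_ext (g := @degree0 l \o milnorK2_map f)) => w /=.
by rewrite milnorK2_map_symbol !degree0_symbol; case: w.
Qed.

Section Homogeneous.
Variables (k : fieldType) (n : nat).

(* No signs or multiplicities are needed, since 2 = 0 in milnorK2 k. *)
Definition homogeneous : {pred milnorK2 k} :=
  fun x => `[< exists s : seq (n.-tuple (kunits k)), x = \sum_(w <- s) symbol w >].

(* K^M_n(k)/2, as the part of degree n of K^M_*(k)/2 *)
Definition milnorK2n := {x : milnorK2 k | x \in homogeneous}.

Lemma homogeneousP (x : milnorK2n) :
  exists s : seq (n.-tuple (kunits k)), val x = \sum_(w <- s) symbol w.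
Proof. exact: asboolW (valP x). Qed.

(* an arbitrary decomposition of x into symbols *)
Definition decomp (x : milnorK2n) : seq (n.-tuple (kunits k)) :=
  projT1 (cid (homogeneousP x)).

Lemma decompP x : val x = \sum_(w <- decomp x) symbol w.
Proof. exact: projT2 (cid (homogeneousP x)). Qed.
End Homogeneous.

Lemma milnorK2_natr_mod2 (k : fieldType) m : m%:R = (m %% 2)%:R :> milnorK2 k.
Proof.
by rewrite {1}(divn_eq m 2) natrD natrM milnorK2_2 mulr0 add0r.
Qed.

Lemma degree0K (k : fieldType) (x : milnorK2n k 0) :
  val x = (degree0 (val x) : nat)%:R.
Proof.
have [s ->] := homogeneousP x.
have -> : \sum_(w <- s) symbol w = (size s)%:R :> milnorK2 k.
  rewrite -sum1_size natr_sum; apply: eq_bigr => w _.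
  by rewrite tuple0 /symbol word_nil rmorph1 rmorph1.
by rewrite rmorph_nat milnorK2_natr_mod2 val_Fp_nat.
Qed.

Lemma homogeneous_map (k l : fieldType) (f : {rmorphism k -> l}) n
    (x : milnorK2n k n) : milnorK2_map f (val x) \in @homogeneous l n.
Proof.
apply/asboolP; exists [seq map_tuple (kunits_map f) w | w <- decomp x].
rewrite decompP rmorph_sum big_map; apply: eq_bigr => w _.
exact: milnorK2_map_symbol.
Qed.

Definition milnorK2n_map (k l : fieldType) (f : {rmorphism k -> l}) n
    (x : milnorK2n k n) : milnorK2n l n :=
  exist _ (milnorK2_map f (val x)) (homogeneous_map f x).

(* The products run through the indices in increasing order. *)
Definition elem_sum (R : pzRingType) (n : nat) (s : seq R) : R :=
  \sum_(L : {set 'I_(size s)} | #|L| == n) \prod_(l in L) s`_l.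

Lemma elem_sum0 (R : pzRingType) (s : seq R) : elem_sum 0 s = 1.
Proof.
rewrite /elem_sum (eq_bigl (pred1 set0)) => [|L]; last by rewrite cards_eq0.
by rewrite big_pred1_eq big_set0.
Qed.

Lemma elem_sum1 (R : pzRingType) (s : seq R) : elem_sum 1 s = \sum_(x <- s) x.
Proof.
rewrite /elem_sum (eq_bigl (mem [set [set l] | l in 'I_(size s)])) => [|L].
  rewrite big_imset => [|l m _ _ /set1_inj //] /=.
  rewrite (eq_bigr (fun l : 'I_(size s) => s`_l)) => [|l _]; last by rewrite big_set1.
  by rewrite (big_nth 0) big_mkord.
by apply/cards1P/imsetP => [[l ->]|[l _ ->]]; exists l.
Qed.

Definition gamma_sum (k : fieldType) i n (s : seq (i.-tuple (kunits k))) :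
    milnorK2 k :=
  elem_sum n [seq symbol (val w) | w <- s].

(* In general this depends on the decomposition chosen by decomp. *)
Definition gamma (k : fieldType) i n (x : milnorK2n k i) : milnorK2 k :=
  gamma_sum n (decomp x).

Lemma gamma0E (k : fieldType) i (x : milnorK2n k i) : gamma 0 x = 1.
Proof. exact: elem_sum0. Qed.

Lemma gamma1E (k : fieldType) i (x : milnorK2n k i) : gamma 1 x = val x.
Proof. by rewrite decompP /gamma /gamma_sum elem_sum1 big_map. Qed.

(* A field extension of k0 is a field k with a morphism k0 -> k. *)
Definition natural_op (k0 : fieldType) (i : nat)
    (phi : forall k : fieldType, {rmorphism k0 -> k} ->
      milnorK2n k i -> milnorK2 k) : Prop :=
  forall (k l : fieldType) (ik : {rmorphism k0 -> k}) (il : {rmorphism k0 -> l})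
    (f : {rmorphism k -> l}),
  (forall a, f (ik a) = il a) ->
  forall x, phi l il (milnorK2n_map f x) = milnorK2_map f (phi k ik x).

Record operation (k0 : fieldType) (i : nat) := Operation {
  op_fun :> forall k : fieldType, {rmorphism k0 -> k} ->
    milnorK2n k i -> milnorK2 k;
  op_natural : natural_op op_fun
}.

Section Operations.
Variables (k0 : fieldType) (i : nat).
Implicit Types (phi psi : operation k0 i) (a : milnorK2 k0).

Lemma op_add_natural phi psi :
  natural_op (fun k ik x => phi k ik x + psi k ik x).
Proof.
move=> k l ik il f fE x.
by rewrite (op_natural phi fE) (op_natural psi fE) [RHS]raddfD.
Qed.
Definition op_add phi psi := Operation (op_add_natural phi psi).

Lemma op_mul_natural phi psi :
  natural_op (fun k ik x => phi k ik x * psi k ik x).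
Proof.
move=> k l ik il f fE x.
by rewrite (op_natural phi fE) (op_natural psi fE) [RHS]rmorphM.
Qed.
Definition op_mul phi psi := Operation (op_mul_natural phi psi).

Lemma op_scale_natural a phi :
  natural_op (fun k ik x => milnorK2_map ik a * phi k ik x).
Proof.
move=> k l ik il f fE x.
by rewrite (op_natural phi fE) -(milnorK2_map_comp fE) [RHS]rmorphM.
Qed.
Definition op_scale a phi := Operation (op_scale_natural a phi).

Lemma op_gamma0_natural :
  natural_op (fun k (_ : {rmorphism k0 -> k}) (x : milnorK2n k i) => gamma 0 x).
Proof. by move=> k l ik il f fE x; rewrite !gamma0E [RHS]rmorph1. Qed.
Definition op_gamma0 : operation k0 i := Operation op_gamma0_natural.

Lemma op_gamma1_natural :
  natural_op (fun k (_ : {rmorphism k0 -> k}) (x : milnorK2n k i) => gamma 1 x).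
Proof. by move=> k l ik il f fE x; rewrite !gamma1E. Qed.
Definition op_gamma1 : operation k0 i := Operation op_gamma1_natural.

Definition op_basis2 (e1 e2 : operation k0 i) : Prop :=
  forall phi : operation k0 i, exists! a : milnorK2 k0 * milnorK2 k0,
    phi = op_add (op_scale a.1 e1) (op_scale a.2 e2).

(* phi takes its values in degrees at most D, for some D uniform in k and x. *)
Definition bounded_degree (phi : operation k0 i) : Prop :=
  exists D : nat, forall (k : fieldType) (ik : {rmorphism k0 -> k}) x,
    exists c : forall d : 'I_D.+1, milnorK2n k d,
      phi k ik x = \sum_d val (c d).

Definition tau (x : milnorK2 k0) : milnorK2 k0 :=
  symbol [:: kunits_N1 k0] ^+ i.-1 * x.

Definition ker_coefs (y : nat -> milnorK2 k0) : Prop :=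
  forall n, (2 <= n)%N -> tau (y n) = 0.

Definition gamma_comb (y : {fsfun nat -> milnorK2 k0 with 0}) (k : fieldType)
    (ik : {rmorphism k0 -> k}) (x : milnorK2n k i) : milnorK2 k :=
  \sum_(n <- finsupp y) milnorK2_map ik (y n) * gamma n x.

(* The infinite sum of the y n * gamma n x over all n: if x is decomposed into l
   symbols, then gamma n x is an empty sum for n > l. Such a sum with infinitely
   many nonzero y n can be a well-defined operation, e.g. the sum of all gamma n
   if i >= 2 and {-1} = 0, but then it does not have bounded degree. *)
Definition gamma_series (y : nat -> milnorK2 k0) (k : fieldType)
    (ik : {rmorphism k0 -> k}) (x : milnorK2n k i) : milnorK2 k :=
  \sum_(n < (size (decomp x)).+1) milnorK2_map ik (y n) * gamma n x.

End Operations.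

Lemma fun_op_natural (k0 : fieldType) (f : 'F_2 -> milnorK2 k0) :
  natural_op (fun k ik (x : milnorK2n k 0) =>
    milnorK2_map ik (f (degree0 (val x)))).
Proof.
move=> k l ik il g gE x.
by rewrite [degree0 _]degree0_map (milnorK2_map_comp gE).
Qed.

Definition fun_op (k0 : fieldType) (f : 'F_2 -> milnorK2 k0) : operation k0 0 :=
  Operation (fun_op_natural f).

(* Main.v *)
Require Import Defs.
From HB Require Import structures.
From mathcomp Require Import all_boot all_order all_algebra.
From mathcomp Require Import finmap monalg boolp.
From mathcomp Require Import zify ring.

Set Implicit Arguments.
Unset Strict Implicit.
Unset Printing Implicit Defensive.

Import GRing.Theory.
Local Open Scope ring_scope.

(** Write K(k) for the Milnor K-ring of a field k modulo 2. It is commutative, and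
    \{a}^2 = \{-1} \{a}. Everything is deduced from one-variable function fields.

    The heart is [unit_family_affine]. Let psi(a) in K(l) be given for each unit a
    of each extension l of k, naturally in l and depending only on \{a}. The
    extension t |-> a u^2 from k(t) to l(u) sends \{t} to \{a u^2} = \{a}, hence it
    sends z = psi(t) to the constant psi(a), which the specialization at u = oo
    recovers. On the other hand that specialization maps the image of a symbol
    \{f(t)} to \{c a^d}, with c the leading coefficient and d the degree of f. So
    only the value of z at t = oo matters: it is an element y0 + y1 e of the ring
    K(k)[e]/(e^2 = \{-1} e), where e stands for the class of t, and
    psi(a) = y0 + y1 \{a}. This determines psi in every characteristic and needs
    no description of K(k(t)).

    Applied to one entry after the other, this shows that a family indexed by
    words (a_1, ..., a_r) which depends only on the \{a_j} and vanishes when some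
    a_j is 1 has the form y \{a_1, ..., a_r} ([word_family_symbol]). For an operation
    phi on K_i and a symbol s, phi(x + s) - phi(x) is such a family: phi(x + s) =
    phi(x) + phi'(x) s for another operation phi' ([derivative_ex]). Iterating,
    phi is the sum of the y_n gamma_n with y_n the value at 0 of the n-th
    derivative ([taylor_expansion]). If s = \{a, w} and t = \{b, w} then s + t is
    the symbol \{ab, w}, which forces phi''(x) s t = 0; as
    s t = \{a, b, w} \{-1}^(i-1) and a, b, w may be taken generic, \{-1}^(i-1)
    kills phi'', and in particular the y_n with n >= 2 ([tau_taylor]).

    Generic entries are removed from a product by the residue at infinity, the
    coefficient of e ([degree_lt_words]). This gives the uniqueness of the y_n,
    and their vanishing for large n when phi has bounded degree.

    Conversely let \{-1}^(i-1) y = 0. Then y s^2 = 0 for each symbol s of degree i,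
    and modulo the annihilator of y the product of the polynomials 1 + s X over the
    symbols s of a decomposition is multiplicative on the free abelian group on
    words of length i, and trivial on the relations of K_i(k). So y gamma_n, a
    coefficient of this product times y, does not depend on the decomposition
    ([gamma_sum_unique]). *)

(** * The Milnor K-ring modulo 2 *)

Section UnitGroup.
Variable k : fieldType.
Implicit Types a b : kunits k.

Definition kunit (x : k) (x_neq0 : x != 0) : kunits k := exist _ x x_neq0.
Definition kmul a b := kunit (mulf_neq0 (valP a) (valP b)).
Definition kone := kunit (oner_neq0 k).
Definition kinv a := kunit (etrans (congr1 negb (invr_eq0 _)) (valP a)).
Definition kopp a := kunit (etrans (congr1 negb (oppr_eq0 _)) (valP a)).

End UnitGroup.

Notation "\{ a }" := (symbol [:: a]) (at level 0, a at level 99, format "\{ a }").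

Section SymbolCalculus.
Variable k : fieldType.
Implicit Types (a b : kunits k) (x y : milnorK2 k).

Lemma symbol_nil : symbol [::] = 1 :> milnorK2 k.
Proof. by rewrite /symbol word_nil !rmorph1. Qed.

Lemma symbol_cat (w1 w2 : seq (kunits k)) : symbol (w1 ++ w2) = symbol w1 * symbol w2.
Proof. by rewrite /symbol word_cat !rmorphM. Qed.

Lemma symbol_cons a (w : seq (kunits k)) : symbol (a :: w) = \{a} * symbol w.
Proof. by rewrite -symbol_cat. Qed.

Lemma milnorK2_addxx x : x + x = 0.
Proof. by rewrite -mulr2n -mulr_natl milnorK2_2 mul0r. Qed.

Lemma milnorK2_oppx x : - x = x.
Proof. by rewrite -[RHS]addr0 -(subrr x) addrA milnorK2_addxx add0r. Qed.

Lemma milnorK2_add_eq0 x y : x + y = 0 -> x = y.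
Proof. by move=> xy; rewrite -[RHS]add0r -xy -addrA milnorK2_addxx addr0. Qed.

Lemma symbol1M a b c : val c = val a * val b -> \{c} = \{a} + \{b} :> milnorK2 k.
Proof.
move=> abc; have [/(congr1 (@mod2 k))] := (ringquot_proj_gen (milnor_rel_mul abc)).
rewrite -/(to_milnorK _) (raddfB (@to_milnorK k)) (raddfD (@to_milnorK k)).
rewrite (raddfB (@mod2 k)) (raddfD (@mod2 k)) (raddf0 (@mod2 k)).
by move=> /eqP; rewrite subr_eq0 => /eqP.
Qed.

Lemma symbol_kmul a b : \{kmul a b} = \{a} + \{b}.
Proof. exact: symbol1M. Qed.

Lemma symbol_kone : \{kone k} = 0.
Proof.
apply: (addrI \{kone k}); rewrite addr0 -symbol_kmul.
by congr \{_}; apply: val_inj; rewrite /= mulr1.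
Qed.

Lemma symbol_kinv a : \{kinv a} = \{a}.
Proof.
apply: milnorK2_add_eq0; rewrite -symbol_kmul -symbol_kone.
by congr \{_}; apply: val_inj; rewrite /= mulVf // (valP a).
Qed.

Lemma symbol_kopp a : \{kopp a} = \{a} + \{kunits_N1 k}.
Proof. by apply: symbol1M; rewrite /= mulrN1. Qed.

Lemma symbol_steinberg a b : val a + val b = 1 -> \{a} * \{b} = 0.
Proof.
move=> ab; rewrite -symbol_cat -[RHS](raddf0 (@mod2 k)); congr mod2.
apply: ringquot_proj_gen.
exact: (milnor_rel_steinberg (w := [tuple a; b]) (r := 0) (s := 1)).
Qed.

(** For a <> 1, - a = (1 - a) / (1 - 1/a), and both factors are Steinberg partners
    of a, up to the inversion of a. *)
Lemma symbol_aNa a : \{a} * \{kopp a} = 0.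
Proof.
have [a1|a1] := eqVneq (val a) 1.
  by have -> : a = kone k; [exact: val_inj | rewrite symbol_kone mul0r].
have b0 : 1 - val a != 0 by rewrite subr_eq0 eq_sym.
have c0 : 1 - (val a)^-1 != 0.
  by rewrite subr_eq0 -[X in X == _]invr1 (inj_eq (can_inj invrK)) eq_sym.
pose b := kunit b0; pose c := kunit c0.
have -> : \{kopp a} = \{b} + \{c}.
  rewrite -(symbol_kinv c); apply: symbol1M => /=.
  have /(congr1 (fun x : k => x / (1 - (val a)^-1))) : - val a * (1 - (val a)^-1) = 1 - val a.
    by rewrite mulrBr mulr1 mulNr divff ?(valP a) // opprK addrC.
  by rewrite mulfK.
rewrite mulrDr symbol_steinberg ?add0r /=; last by rewrite addrC subrK.
by rewrite -(symbol_kinv a) symbol_steinberg //= addrC subrK.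
Qed.

(** Expand \{ab} \{-ab} = 0 by bilinearity. *)
Lemma symbol_commute a b : \{a} * \{b} = \{b} * \{a}.
Proof.
apply: milnorK2_add_eq0; have := symbol_aNa (kmul a b).
have -> : \{kopp (kmul a b)} = \{kopp a} + \{b}.
  by apply: symbol1M; rewrite /= mulNr.
rewrite symbol_kmul mulrDl !mulrDr symbol_aNa add0r.
have -> : \{kopp a} = \{kopp b} + \{kmul a (kinv b)}.
  apply: symbol1M => /=; by rewrite mulNr mulrCA divff ?mulr1 // (valP b).
rewrite symbol_kmul symbol_kinv !mulrDr symbol_aNa add0r => <-.
by congr (_ + _); rewrite -addrA milnorK2_addxx addr0.
Qed.

(** Since 2 = 0, an integral combination of symbols is the sum of those with an odd
    coefficient. *)
Lemma milnorK2_symbol_ind (P : milnorK2 k -> Prop) :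
  P 0 -> (forall w x, P x -> P (symbol w + x)) -> forall x, P x.
Proof.
move=> P0 PD; apply: milnorK2_ind => x; rewrite [x]free_ringE !raddf_sum.
elim/big_rec: _ => // m y _ Py.
rewrite mulrzl !raddfMz /= -/(symbol _); set s := symbol _.
have -> : s *~ x@_m = s *+ odd `|x@_m|%N.
  have H n : s *+ n = s *+ odd n.
    by rewrite -{1}(odd_double_half n) mulrnDr -mul2n mulrnA mulr2n milnorK2_addxx mul0rn addr0.
  case: (x@_m) => n; first exact: H.
  by rewrite NegzE mulrNz milnorK2_oppx abszN; exact: H.
by case: odd; rewrite ?mulr0n ?add0r //; apply: PD.
Qed.

Lemma milnorK2_mulC : commutative (@GRing.mul (milnorK2 k)).
Proof.
have Hw a w : \{a} * symbol w = symbol w * \{a}.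
  elim: w => [|b w IHw]; first by rewrite symbol_nil mulr1 mul1r.
  by rewrite (symbol_cons b) mulrA symbol_commute -!mulrA IHw.
have Hww (v w : seq (kunits k)) : symbol v * symbol w = symbol w * symbol v.
  elim: v => [|a v IHv]; first by rewrite symbol_nil mulr1 mul1r.
  by rewrite (symbol_cons a) -mulrA IHv !mulrA Hw.
have Hx (v : seq (kunits k)) y : symbol v * y = y * symbol v.
  elim/milnorK2_symbol_ind: y => [|w y IHy]; first by rewrite mulr0 mul0r.
  by rewrite mulrDl mulrDr IHy Hww.
move=> x y; elim/milnorK2_symbol_ind: x => [|w x IHx]; first by rewrite mulr0 mul0r.
by rewrite mulrDl mulrDr IHx Hx.
Qed.

End SymbolCalculus.

(** This instance makes the theory of commutative rings, polynomials over
    [milnorK2 k] in particular, and the [ring] tactic available. *)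
HB.instance Definition _ k :=
  GRing.PzRing_hasCommutativeMul.Build (milnorK2 k) (@milnorK2_mulC k).

Lemma symbol_sqr (k : fieldType) (a : kunits k) :
  \{a} * \{a} = \{kunits_N1 k} * \{a}.
Proof.
apply: milnorK2_add_eq0; rewrite -mulrDl addrC [LHS]mulrC addrC -symbol_kopp.
by rewrite -[RHS](symbol_aNa a).
Qed.

Lemma milnorK2_mapM (k l : fieldType) (f : {rmorphism k -> l}) x y :
  milnorK2_map f (x * y) = milnorK2_map f x * milnorK2_map f y.
Proof. exact: rmorphM. Qed.

Lemma milnorK2_mapD (k l : fieldType) (f : {rmorphism k -> l}) x y :
  milnorK2_map f (x + y) = milnorK2_map f x + milnorK2_map f y.
Proof. exact: rmorphD. Qed.

Lemma milnorK2_map0 (k l : fieldType) (f : {rmorphism k -> l}) :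
  milnorK2_map f 0 = 0.
Proof. exact: raddf0. Qed.

Lemma milnorK2_map_symbol1 (k l : fieldType) (f : {rmorphism k -> l}) a :
  milnorK2_map f \{a} = \{kunits_map f a}.
Proof. exact: milnorK2_map_symbol. Qed.

Lemma kunits_map_N1 (k l : fieldType) (f : {rmorphism k -> l}) :
  kunits_map f (kunits_N1 k) = kunits_N1 l.
Proof. by apply: val_inj; rewrite /= rmorphN1. Qed.

Lemma milnorK2_map_id (k : fieldType) (x : milnorK2 k) : milnorK2_map idfun x = x.
Proof.
apply: (milnorK2_ext (g := milnorK2_map idfun) (h := idfun)) => w /=.
rewrite milnorK2_map_symbol; congr symbol; rewrite -[RHS]map_id.
by apply: eq_map => a; apply: val_inj.
Qed.

(** * Universal property of the K-ring, and the ring A[e] with e^2 = c e *)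

Section UniversalProperty.
Variables (k : fieldType) (S : comNzRingType) (h : kunits k -> S).
Hypothesis hM : forall a b c, val c = val a * val b -> h c = h a + h b.
Hypothesis h_steinberg : forall a b, val a + val b = 1 -> h a * h b = 0.
Hypothesis S2 : 2%:R = 0 :> S.

Lemma free_lift_rel x : milnor_rel x -> free_lift h x = 0.
Proof.
case=> [a b c abc|n w r s rs ars].
  rewrite raddfB raddfD [X in X - _]free_liftE [X in _ - (X + _)]free_liftE.
  by rewrite [X in _ - (_ + X)]free_liftE !big_seq1 (hM abc) subrr.
rewrite [LHS]free_liftE big_tuple (bigD1 r) //= (bigD1 s) /=; last by rewrite -val_eqE /= gtn_eqF.
by rewrite mulrA h_steinberg ?mul0r.
Qed.

Definition milnorK2_eval : milnorK2 k -> S := milnorK2_lift free_lift_rel S2.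
HB.instance Definition _ := GRing.RMorphism.on milnorK2_eval.

Lemma milnorK2_evalE w : milnorK2_eval (symbol w) = \prod_(a <- w) h a.
Proof. exact: etrans (milnorK2_liftE _ _ _) (free_liftE _ w). Qed.

Lemma milnorK2_eval1 a : milnorK2_eval \{a} = h a.
Proof. by rewrite milnorK2_evalE big_seq1. Qed.

End UniversalProperty.

Lemma milnorK2_ext1 (k : fieldType) (S : comNzRingType)
    (g h : {rmorphism milnorK2 k -> S}) :
  (forall a, g \{a} = h \{a}) -> g =1 h.
Proof.
move=> gh; apply: milnorK2_ext; elim=> [|a w IHw].
  by rewrite symbol_nil !rmorph1.
by rewrite (symbol_cons a) !rmorphM IHw gh.
Qed.

(** The pair (x, y) stands for x + y e in A[e]/(e^2 = c e). *)
Definition twisted_dual (A : comNzRingType) (c : A) : Type := (A * A)%type.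

Section TwistedDual.
Variables (A : comNzRingType) (c : A).
Local Notation T := (twisted_dual c).
HB.instance Definition _ := GRing.Zmodule.on T.

Definition td_one : T := (1, 0).
Definition td_mul (x y : T) : T :=
  (x.1 * y.1, x.1 * y.2 + x.2 * y.1 + c * x.2 * y.2).

Lemma td_mulA : associative td_mul.
Proof. by move=> [a a'] [b b'] [d d']; rewrite /td_mul /=; congr (_, _); ring. Qed.
Lemma td_mulC : commutative td_mul.
Proof. by move=> [a a'] [b b']; rewrite /td_mul /=; congr (_, _); ring. Qed.
Lemma td_mul1 : left_id td_one td_mul.
Proof. by move=> [a a']; rewrite /td_mul /=; congr (_, _); ring. Qed.
Lemma td_mulDl : left_distributive td_mul +%R.
Proof. by move=> [a a'] [b b'] [d d']; rewrite /td_mul /=; congr (_, _) => /=; ring. Qed.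
Lemma td_one_neq0 : td_one != 0.
Proof. by rewrite xpair_eqE oner_eq0. Qed.

HB.instance Definition _ := GRing.Zmodule_isComNzRing.Build T
  td_mulA td_mulC td_mul1 td_mulDl td_one_neq0.

Lemma td_mulE (x y : T) : x * y = td_mul x y. Proof. by []. Qed.
Lemma td_addE (x y : T) : x + y = (x.1 + y.1, x.2 + y.2). Proof. by []. Qed.

Definition td_const (x : A) : T := (x, 0).
Lemma td_const_zmod : zmod_morphism td_const.
Proof. by move=> x y; rewrite /td_const; congr (_, _); rewrite /= subrr. Qed.
Lemma td_const_monoid : monoid_morphism td_const.
Proof.
by split=> // x y; rewrite td_mulE /td_mul /td_const /= !(mulr0, mul0r, addr0).
Qed.
HB.instance Definition _ := GRing.isZmodMorphism.Build A T td_const td_const_zmod.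
HB.instance Definition _ := GRing.isMonoidMorphism.Build A T td_const td_const_monoid.

Variables (S : comNzRingType) (g : {rmorphism A -> S}) (e : S).

(** The morphism that extends g and sends the generator to e. *)
Definition td_eval of e * e = g c * e := fun x : T => g x.1 + g x.2 * e.

Hypothesis eE : e * e = g c * e.

Lemma td_eval_zmod : zmod_morphism (td_eval eE).
Proof. by move=> [a a'] [b b']; rewrite /td_eval /= !rmorphB; ring. Qed.
Lemma td_eval_monoid : monoid_morphism (td_eval eE).
Proof.
split=> [|[a a'] [b b']]; first by rewrite /td_eval /= rmorph1 rmorph0 mul0r addr0.
rewrite /td_eval /= !(rmorphD, rmorphM) !mulrDl.
rewrite !mulrDr (_ : g a' * e * (g b' * e) = g a' * g b' * (e * e)); last by ring.
by rewrite eE; ring.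
Qed.
HB.instance Definition _ := GRing.isZmodMorphism.Build T S (td_eval eE) td_eval_zmod.
HB.instance Definition _ := GRing.isMonoidMorphism.Build T S (td_eval eE) td_eval_monoid.

End TwistedDual.

(** * Rational functions *)

Section FractionLift.
Variables (R : idomainType) (F : fieldType) (h : {rmorphism R -> F}).
Local Notation tofrac := (@FracField.tofrac R).

(** The equality of the last two conditions is used for a unit f, whose numerator has
    to be nonzero. *)
Lemma fraction_ex (f : {fraction R}) : exists p q : R,
  [/\ q != 0, f = tofrac p / tofrac q & (f != 0) = (p != 0)].
Proof.
have [p [q [q0 fE]]] : exists p q : R, q != 0 /\ f = tofrac p / tofrac q.
  elim/quotW: f => x; exists (frac x).1, (frac x).2; split; first exact: denom_ratioP.
  apply: (@mulIf _ (tofrac (frac x).2)); first by rewrite tofrac_eq0 denom_ratioP.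
  rewrite divfK ?tofrac_eq0 ?denom_ratioP //; unlock FracField.tofrac.
  rewrite -[LHS]FracField.pi_mul; apply/eqmodP => /=.
  rewrite FracField.equivfE /FracField.mulf !numden_Ratio ?(oner_neq0, mulr1, denom_ratioP) //.
  by rewrite mulrC.
exists p, q; split=> //.
by rewrite fE mulf_eq0 negb_or invr_eq0 !tofrac_eq0 q0 andbT.
Qed.

Definition fnum f := projT1 (cid (fraction_ex f)).
Definition fden f := projT1 (cid (projT2 (cid (fraction_ex f)))).
Lemma fraction_spec f : [/\ fden f != 0, f = tofrac (fnum f) / tofrac (fden f) &
  (f != 0) = (fnum f != 0)].
Proof. exact: projT2 (cid (projT2 (cid (fraction_ex f)))). Qed.

Lemma fraction_eq (p q p' q' : R) : q != 0 -> q' != 0 ->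
  tofrac p / tofrac q = tofrac p' / tofrac q' -> p * q' = p' * q.
Proof.
move=> q0 q'0 /eqP; rewrite eqr_div ?tofrac_eq0 // -!rmorphM tofrac_eq => /eqP.
by [].
Qed.

Definition fraction_lift of (forall p : R, p != 0 -> h p != 0) :=
  fun f => h (fnum f) / h (fden f).

Hypothesis h_inj : forall p : R, p != 0 -> h p != 0.

Lemma fraction_liftE p q : q != 0 ->
  fraction_lift h_inj (tofrac p / tofrac q) = h p / h q.
Proof.
move=> q0; rewrite /fraction_lift.
have [d0 fE _] := fraction_spec (tofrac p / tofrac q).
by apply/eqP; rewrite eqr_div ?h_inj // -!rmorphM (fraction_eq q0 d0 fE).
Qed.

Lemma fraction_lift_tofrac p : fraction_lift h_inj (tofrac p) = h p.
Proof.
by have := fraction_liftE p (oner_neq0 R); rewrite !rmorph1 !divr1.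
Qed.

Lemma fraction_lift_zmod : zmod_morphism (fraction_lift h_inj).
Proof.
move=> f g; have [p [q [q0 -> _]]] := fraction_ex f.
have [p' [q' [q'0 -> _]]] := fraction_ex g.
rewrite -mulNr addf_div ?tofrac_eq0 // -!rmorphN -!rmorphM -rmorphD.
rewrite !fraction_liftE ?mulf_neq0 //.
by rewrite -mulNr addf_div ?h_inj // -!rmorphN -!rmorphM -rmorphD.
Qed.

Lemma fraction_lift_monoid : monoid_morphism (fraction_lift h_inj).
Proof.
split=> [|f g]; first by rewrite -(rmorph1 tofrac) fraction_lift_tofrac rmorph1.
have [p [q [q0 -> _]]] := fraction_ex f.
have [p' [q' [q'0 -> _]]] := fraction_ex g.
rewrite mulf_div -!rmorphM !fraction_liftE ?mulf_neq0 //.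
by rewrite mulf_div -!rmorphM.
Qed.

HB.instance Definition _ := GRing.isZmodMorphism.Build {fraction R} F
  (fraction_lift h_inj) fraction_lift_zmod.
HB.instance Definition _ := GRing.isMonoidMorphism.Build {fraction R} F
  (fraction_lift h_inj) fraction_lift_monoid.

End FractionLift.

(** * The place at infinity of a rational function field *)

Notation ratfun k := {fraction {poly k}}.

Lemma char2_swap (V : zmodType) (V2 : forall x : V, x + x = 0) (a b c d : V) :
  a + b = c + d -> a + d = c + b.
Proof.
move=> abcd; have H x y : x + y + y = x :> V by rewrite -addrA V2 addr0.
by rewrite -(H (a + d) b) (addrAC a) abcd H.
Qed.

Section Infinity.
Variable k : fieldType.
Local Notation F := (ratfun k).
Local Notation T := (twisted_dual \{kunits_N1 k}).
Local Notation tofrac := (@FracField.tofrac {poly k}).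

Definition lead_unit (p : {poly k}) : kunits k := insubd (kone k) (lead_coef p).

Lemma lead_unitE p : p != 0 -> val (lead_unit p) = lead_coef p.
Proof. by move=> p0; rewrite insubdK // unfold_in lead_coef_eq0. Qed.

(** A polynomial c t^d + ... behaves at infinity like c t^d, that is \{c} + d e,
    where e stands for \{t}. *)
Definition leading (p : {poly k}) : T := (\{lead_unit p}, (size p).-1%:R).

Lemma leadingM p q : p != 0 -> q != 0 -> leading (p * q) = leading p + leading q.
Proof.
move=> p0 q0; rewrite td_addE /leading /=; congr (_, _).
  by apply: symbol1M; rewrite !lead_unitE ?mulf_neq0 // lead_coefM.
rewrite -natrD size_mul //; congr (_%:R).
move: p0 q0; rewrite -!size_poly_gt0; move: (size p) (size q) => m n; lia.
Qed.

Lemma td_addxx (x : T) : x + x = 0.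
Proof. by rewrite td_addE !milnorK2_addxx. Qed.

Definition infinity (f : kunits F) : T := leading (fnum (val f)) + leading (fden (val f)).

Lemma infinityE (f : kunits F) p q : p != 0 -> q != 0 -> val f = tofrac p / tofrac q ->
  infinity f = leading p + leading q.
Proof.
move=> p0 q0 fE; rewrite /infinity; have [d0 fE' nE] := fraction_spec (val f).
have n0 : fnum (val f) != 0 := etrans (esym nE) (valP f).
apply: (char2_swap td_addxx); rewrite -!leadingM //.
by rewrite (fraction_eq d0 q0 (etrans (esym fE') fE)).
Qed.

Lemma leading_form (p q : {poly k}) : exists a (n : nat), leading p + leading q = (\{a}, n%:R).
Proof.
exists (kmul (lead_unit p) (lead_unit q)), ((size p).-1 + (size q).-1)%N.
by rewrite symbol_kmul natrD.
Qed.

(** With X = \{a} + n e, this is X (X + \{-1}) = 0, i.e. X^2 = \{-1} X: the relation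
    imposed on e is the one that every \{a} satisfies. *)
Lemma td_pole a (n : nat) :
  ((\{a}, n%:R) : T) * ((\{a}, n%:R) + (\{kunits_N1 k}, 0)) = 0.
Proof.
rewrite td_mulE td_addE /td_mul /= addr0; congr (_, _).
  by rewrite mulrDr symbol_sqr mulrC milnorK2_addxx.
rewrite milnorK2_natr_mod2 modn2.
case: odd => /=; last by rewrite !(mulr0, mul0r, addr0).
by rewrite !(mulr1, mul1r) addrA milnorK2_addxx add0r milnorK2_addxx.
Qed.

Lemma infinityM f g h : val h = val f * val g -> infinity h = infinity f + infinity g.
Proof.
move=> hfg; rewrite /(infinity f) /(infinity g).
have [df fE nf] := fraction_spec (val f).
have [dg gE ng] := fraction_spec (val g).
have {}nf : fnum (val f) != 0 := etrans (esym nf) (valP f).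
have {}ng : fnum (val g) != 0 := etrans (esym ng) (valP g).
rewrite [RHS]addrACA -(leadingM nf ng) -(leadingM df dg).
apply: infinityE; rewrite ?mulf_neq0 //.
by rewrite hfg [in LHS]fE [in LHS]gE mulf_div -!rmorphM.
Qed.

Lemma leading_eq (p q : {poly k}) : size p = size q -> lead_coef p = lead_coef q ->
  leading p = leading q.
Proof. by move=> pq pq'; rewrite /leading /lead_unit pq pq'. Qed.

(** The leading coefficients of f and 1 - f at infinity satisfy the Steinberg
    relation when f is finite there, and are opposite when f has a pole; the
    relation e^2 = \{-1} e is what makes the product vanish in the latter case. *)
Lemma infinity_steinberg f g : val f + val g = 1 -> infinity f * infinity g = 0.
Proof.
move=> fg; have [q0 fE nf] := fraction_spec (val f).
have {nf} p0 : fnum (val f) != 0 := etrans (esym nf) (valP f).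
move: (fnum _) (fden _) p0 q0 fE => p q p0 q0 fE.
have gE : val g = tofrac (q - p) / tofrac q.
  have -> : val g = 1 - val f by rewrite -fg addrC addKr.
  by rewrite rmorphB mulrBl divff ?tofrac_eq0 // -fE.
have r0 : q - p != 0.
  by apply: contraTneq (valP g) => r0; rewrite gE r0 rmorph0 mul0r eqxx.
rewrite (infinityE p0 q0 fE) (infinityE r0 q0 gE).
have [spq|sqp|spq] := ltngtP (size p) (size q).
- have -> : leading (q - p) = leading q.
    apply: leading_eq; first by rewrite size_polyDl ?size_polyN.
    by rewrite lead_coefDl ?size_polyN.
  by rewrite td_addxx mulr0.
- have -> : leading (q - p) = leading p + (\{kunits_N1 k}, 0).
    rewrite td_addE /leading /= addr0 addrC size_polyDl ?size_polyN //.
    congr (_, _); apply: symbol1M; rewrite !lead_unitE //=; last by rewrite addrC.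
    by rewrite mulrN1 lead_coefDl ?size_polyN // lead_coefN.
  rewrite addrAC; have [a [n ->]] := leading_form p q.
  exact: td_pole.
have [srq|srq] := ltnP (size (q - p)) (size q).
  have -> : leading p = leading q.
    apply: leading_eq => //; apply/eqP; rewrite eq_sym -subr_eq0 /lead_coef spq.
    by rewrite -coefB nth_default // -ltnS prednK // (leq_trans _ srq).
  by rewrite td_addxx mul0r.
have srqE : size (q - p) = size q.
  apply/eqP; rewrite eqn_leq srq andbT (leq_trans (size_polyD _ _)) //.
  by rewrite size_polyN geq_max spq leqnn.
have Hn (r : {poly k}) : size r = size q -> r != 0 -> leading r + leading q =
   (\{kmul (lead_unit r) (kinv (lead_unit q))}, 0).
  move=> sr r0'; rewrite td_addE /leading /= sr milnorK2_addxx; congr (_, _).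
  by rewrite symbol_kmul symbol_kinv.
rewrite !Hn // td_mulE /td_mul /= !(mulr0, mul0r, addr0); congr (_, _).
apply: symbol_steinberg; rewrite /= !lead_unitE // -mulrDl.
rewrite (_ : _ + _ = lead_coef q) ?divff ?lead_coef_eq0 //.
by rewrite /lead_coef spq srqE coefB addrC subrK.
Qed.

End Infinity.

Section AtInfinity.
Variable k : fieldType.
Local Notation F := (ratfun k).
Local Notation T := (twisted_dual \{kunits_N1 k}).
Local Notation tofrac := (@FracField.tofrac {poly k}).

Fact td2 : 2%:R = 0 :> T.
Proof. exact: td_addxx. Qed.

(** The first component is the specialization at infinity (with respect to the
    uniformizer 1/t), the second one is the residue. *)
Definition at_infinity : milnorK2 F -> T :=
  milnorK2_eval (@infinityM k) (@infinity_steinberg k) td2.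
HB.instance Definition _ := GRing.RMorphism.on at_infinity.

Lemma at_infinity1 f : at_infinity \{f} = infinity f.
Proof. exact: milnorK2_eval1. Qed.

Definition ratfun_const : {rmorphism k -> F} := tofrac \o polyC.

Definition ratfun_X : kunits F :=
  kunit (etrans (congr1 negb (tofrac_eq0 _)) (negbT (polyX_eq0 k))).

Lemma infinity_poly (f : kunits F) p : val f = tofrac p -> infinity f = leading p.
Proof.
move=> fE; have p0 : p != 0 by rewrite -tofrac_eq0 -fE; exact: (valP f).
rewrite (@infinityE _ f p 1) ?oner_neq0 ?rmorph1 ?divr1 //.
rewrite -[RHS]addr0; congr (_ + _); rewrite /leading size_poly1; congr (_, _).
rewrite (_ : lead_unit 1 = kone k) ?symbol_kone //.
by apply: val_inj; rewrite lead_unitE ?oner_neq0 // lead_coef1.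
Qed.

Lemma at_infinity_X : at_infinity \{ratfun_X} = (0, 1).
Proof.
rewrite at_infinity1 (@infinity_poly ratfun_X 'X) // /leading size_polyX.
rewrite (_ : lead_unit 'X = kone k) ?symbol_kone //.
by apply: val_inj; rewrite lead_unitE ?polyX_eq0 // lead_coefX.
Qed.

Lemma at_infinity_const x : at_infinity (milnorK2_map ratfun_const x) = (x, 0).
Proof.
apply: (milnorK2_ext1 (g := at_infinity \o milnorK2_map ratfun_const)
  (h := @td_const _ _)) => a /=.
rewrite milnorK2_map_symbol1 at_infinity1.
rewrite (@infinity_poly _ (val a)%:P) // /leading /td_const.
rewrite (_ : lead_unit _ = a) ?size_polyC ?(valP a) //.
by apply: val_inj; rewrite lead_unitE ?polyC_eq0 ?lead_coefC //; exact: (valP a).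
Qed.

Lemma at_infinity_cons f (w : seq (kunits F)) :
  at_infinity (symbol (f :: w)) = infinity f * at_infinity (symbol w).
Proof. by rewrite (symbol_cons f) -at_infinity1; exact: rmorphM. Qed.

Lemma at_infinity_mulX (y : milnorK2 k) :
  at_infinity (milnorK2_map ratfun_const y * \{ratfun_X}) = (0, y).
Proof.
transitivity (((y, 0) : T) * (0, 1)).
  by rewrite -at_infinity_const -at_infinity_X; exact: rmorphM.
by rewrite td_mulE /td_mul /= !(mulr0, mul0r, mulr1, addr0).
Qed.

End AtInfinity.

Lemma symbol1MX (k : fieldType) (a b c : kunits k) n :
  val c = val a * val b ^+ n -> \{c} = \{a} + n%:R * \{b} :> milnorK2 k.
Proof.
elim: n c => [|n IHn] c cE.
  by rewrite mul0r addr0; congr \{_}; apply: val_inj; rewrite cE mulr1.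
pose d := kmul c (kinv b); have dE : val d = val a * val b ^+ n.
  by rewrite /= cE exprSr mulrA mulfK // (valP b).
rewrite (_ : \{c} = \{d} + \{b}); last first.
  by rewrite symbol_kmul symbol_kinv -addrA milnorK2_addxx addr0.
by rewrite (IHn _ dE) -addrA -natr1 mulrDl mul1r.
Qed.

Section Substitution.
Variables (k l : fieldType) (i : {rmorphism k -> l}) (a : kunits l).

Lemma specialize_eq : \{a} * \{a} = milnorK2_map i \{kunits_N1 k} * \{a}.
Proof. by rewrite milnorK2_map_symbol1 kunits_map_N1 symbol_sqr. Qed.

(** The composite of the place at infinity with e |-> \{a}: it maps \{f} to
    \{c a^d}, with c the leading coefficient of f and d its degree. *)
Definition specialize : milnorK2 (ratfun k) -> milnorK2 l :=
  td_eval specialize_eq \o @at_infinity k.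
HB.instance Definition _ := GRing.RMorphism.on specialize.

Lemma specializeE x : specialize x = milnorK2_map i (at_infinity x).1 +
  milnorK2_map i (at_infinity x).2 * \{a}.
Proof. by []. Qed.

(** Substituting a u^2 rather than a gives a morphism that extends to fractions,
    since a u^2 is transcendental, while \{a u^2} is still \{a}. *)
Definition subst_poly : {rmorphism {poly k} -> {poly l}} :=
  comp_poly (val a *: 'X^2) \o map_poly i.

Let size_q : size (val a *: 'X^2) = 3.
Proof. by rewrite size_scale ?size_polyXn //; exact: (valP a). Qed.

Lemma subst_poly_neq0 p : p != 0 -> subst_poly p != 0.
Proof.
move=> p0; rewrite /= -lead_coef_eq0 lead_coef_comp ?size_q //.
rewrite mulf_neq0 ?expf_neq0 ?lead_coef_eq0 ?map_poly_eq0 //.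
by rewrite -size_poly_eq0 size_q.
Qed.

Fact tofrac_subst_neq0 p : p != 0 -> (@FracField.tofrac _ \o subst_poly) p != 0.
Proof. by move=> p0; rewrite /= tofrac_eq0 subst_poly_neq0. Qed.

Definition subst_ratfun : {rmorphism ratfun k -> ratfun l} :=
  fraction_lift tofrac_subst_neq0.

Lemma leading_subst p : p != 0 ->
  (leading (subst_poly p)).1 = td_eval specialize_eq (leading p).
Proof.
move=> p0; rewrite /td_eval /= milnorK2_map_symbol1 rmorph_nat.
apply: symbol1MX; rewrite !lead_unitE ?subst_poly_neq0 //= lead_unitE //.
rewrite lead_coef_comp ?size_q // lead_coef_map size_map_poly.
by rewrite lead_coefZ lead_coefXn mulr1.
Qed.

(** Both sides are ring morphisms in z, so only the leading coefficient of f(a u^2)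
    has to be computed. *)
Lemma specialize_subst z :
  (at_infinity (milnorK2_map subst_ratfun z)).1 = specialize z.
Proof.
have e0 : 0 * 0 = idfun \{kunits_N1 l} * 0 :> milnorK2 l by rewrite !mulr0.
pose g := td_eval e0 \o (@at_infinity l \o milnorK2_map subst_ratfun).
transitivity (g z); first by rewrite /g /td_eval /= mulr0 addr0.
apply: (milnorK2_ext1 (g := g) (h := specialize)) => f.
rewrite /g /= milnorK2_map_symbol1 /specialize /= !at_infinity1.
have [q0 fE nf] := fraction_spec (val f).
have {nf} p0 : fnum (val f) != 0 := etrans (esym nf) (valP f).
move: (fnum _) (fden _) p0 q0 fE => p q p0 q0 fE.
rewrite (infinityE p0 q0 fE).
have /(infinityE (subst_poly_neq0 p0) (subst_poly_neq0 q0)) -> :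
  val (kunits_map subst_ratfun f) =
    FracField.tofrac (subst_poly p) / FracField.tofrac (subst_poly q).
  by rewrite /= fE; exact: fraction_liftE.
have -> : td_eval specialize_eq (leading p + leading q) =
    td_eval specialize_eq (leading p) + td_eval specialize_eq (leading q).
  exact: raddfD.
rewrite -!leading_subst //.
by rewrite /td_eval /= mulr0 addr0.
Qed.

End Substitution.

(** * Families of elements indexed by units *)

Section UnitFamilies.
Variable k : fieldType.
Variable psi : forall l : fieldType, {rmorphism k -> l} -> kunits l -> milnorK2 l.

Definition unit_natural := forall (l m : fieldType) (i : {rmorphism k -> l})
  (j : {rmorphism k -> m}) (f : {rmorphism l -> m}), (forall a, f (i a) = j a) ->
  forall a, psi j (kunits_map f a) = milnorK2_map f (psi i a).

Hypothesis psi_natural : unit_natural.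
Hypothesis psi_symbol : forall (l : fieldType) (i : {rmorphism k -> l}) a b,
  \{a} = \{b} -> psi i a = psi i b.

(** The coefficients are the two components at infinity of the value at the generic
    unit t of k(t); that value is mapped by t |-> a u^2 to psi(a), because psi does
    not distinguish a u^2 from a. *)
Lemma unit_family_affine : exists y0 y1, forall (l : fieldType) (i : {rmorphism k -> l}) a,
  psi i a = milnorK2_map i y0 + milnorK2_map i y1 * \{a}.
Proof.
pose z := psi (ratfun_const k) (ratfun_X k).
exists (at_infinity z).1, (at_infinity z).2 => l i a.
rewrite -(specializeE i a) -specialize_subst.
pose c := ratfun_const l; pose j : {rmorphism k -> ratfun l} := c \o i.
have jE : forall b, subst_ratfun i a (ratfun_const k b) = j b.
  move=> b; rewrite /= fraction_lift_tofrac /= map_polyC /= comp_polyC.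
  by [].
rewrite -(psi_natural jE) (@psi_symbol _ j _ (kunits_map c a)).
  by rewrite (@psi_natural _ _ i j c) // at_infinity_const.
have -> : \{kunits_map c a} = \{kunits_map c a} + 2%:R * \{ratfun_X l}.
  by rewrite milnorK2_2 mul0r addr0.
apply: symbol1MX; rewrite /= fraction_lift_tofrac /= map_polyX comp_polyX.
by rewrite -mul_polyC rmorphM rmorphXn.
Qed.

End UnitFamilies.

(** * The filtration by degree *)

Section DegreeFiltration.
Implicit Types (k l : fieldType).

(** The strict bound makes 0 the only element of degree less than 0, so that a
    statement on degrees contains, for d = 0, an injectivity statement. *)
Definition degree_lt k d (x : milnorK2 k) : Prop :=
  exists2 s : seq (seq (kunits k)), all (fun w => size w < d)%N s & x = \sum_(w <- s) symbol w.

Lemma degree_lt_symbol k d (w : seq (kunits k)) : (size w < d)%N -> degree_lt d (symbol w).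
Proof. by move=> wd; exists [:: w]; rewrite /= ?wd ?big_seq1. Qed.

Lemma degree_lt0 k d : degree_lt d (0 : milnorK2 k).
Proof. by exists [::]; rewrite ?big_nil. Qed.

Lemma degree_ltD k d (x y : milnorK2 k) :
  degree_lt d x -> degree_lt d y -> degree_lt d (x + y).
Proof.
by move=> [s sd ->] [t td ->]; exists (s ++ t); rewrite ?all_cat ?sd // big_cat.
Qed.

Lemma degree_lt_sum k d (T : eqType) (r : seq T) (x : T -> milnorK2 k) :
  (forall i, i \in r -> degree_lt d (x i)) -> degree_lt d (\sum_(i <- r) x i).
Proof.
move=> xd; rewrite big_seq; elim/big_ind: _ => //; first exact: degree_lt0.
exact: degree_ltD.
Qed.

Lemma degree_ltW k d e (x : milnorK2 k) : (d <= e)%N -> degree_lt d x -> degree_lt e x.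
Proof.
move=> de [s sd ->]; exists s => //; apply/allP => w /(allP sd) wd.
exact: leq_trans de.
Qed.

Lemma degree_lt_symbolM k d (w : seq (kunits k)) x :
  degree_lt d x -> degree_lt (size w + d) (symbol w * x).
Proof.
move=> [s sd ->]; rewrite mulr_sumr; apply: degree_lt_sum => v /(allP sd) vd.
by rewrite -symbol_cat; apply: degree_lt_symbol; rewrite size_cat ltn_add2l.
Qed.

Lemma degree_ltM k d e (x y : milnorK2 k) :
  degree_lt d.+1 x -> degree_lt e y -> degree_lt (d + e) (x * y).
Proof.
move=> [s sd ->] ye; rewrite mulr_suml; apply: degree_lt_sum => v /(allP sd) vd.
by apply: degree_ltW (degree_lt_symbolM v ye); rewrite leq_add2r.
Qed.

Lemma degree_lt_nat k d n : degree_lt d.+1 (n%:R : milnorK2 k).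
Proof.
elim: n => [|n IHn]; first exact: degree_lt0.
by rewrite mulrS; apply: degree_ltD => //; rewrite -(symbol_nil k); exact: degree_lt_symbol.
Qed.

Lemma degree_lt_map k l (f : {rmorphism k -> l}) d x :
  degree_lt d x -> degree_lt d (milnorK2_map f x).
Proof.
move=> [s sd ->]; rewrite raddf_sum /=; apply: degree_lt_sum => w /(allP sd) wd.
by rewrite milnorK2_map_symbol; apply: degree_lt_symbol; rewrite size_map.
Qed.

Lemma degree_lt_ex k (x : milnorK2 k) : exists d, degree_lt d x.
Proof.
elim/milnorK2_symbol_ind: x => [|w x [d xd]]; first by exists 0; exact: degree_lt0.
exists (maxn (size w).+1 d); apply: degree_ltD; last by apply: degree_ltW xd; rewrite leq_maxr.
by apply: degree_lt_symbol; rewrite leq_max ltnSn.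
Qed.

Lemma degree_lt0_eq0 k (x : milnorK2 k) : degree_lt 0 x -> x = 0.
Proof. by move=> [[|w s] //= _ ->]; rewrite big_nil. Qed.

(** A symbol of length n is mapped by [at_infinity] to x + y e with x of degree n and
    y of degree n - 1. *)
Lemma degree_lt_residue k d (x : milnorK2 (ratfun k)) :
  degree_lt d x -> degree_lt d.-1 (at_infinity x).2.
Proof.
move=> [s sd ->].
have Hw (w : seq (kunits (ratfun k))) : degree_lt (size w).+1 (at_infinity (symbol w)).1 /\
    degree_lt (size w) (at_infinity (symbol w)).2.
  elim: w => [|f w [IH1 IH2]].
    rewrite symbol_nil rmorph1; split; last exact: degree_lt0.
    exact: (@degree_lt_nat _ _ 1).
  rewrite at_infinity_cons /infinity.
  have [a [n ->]] := leading_form (fnum (val f)) (fden (val f)).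
  move: (at_infinity (symbol w)) IH1 IH2 => y IH1 IH2.
  rewrite td_mulE /td_mul [_.1]/= [_.2]/=; split; first exact: (degree_lt_symbolM [:: a]).
  apply: degree_ltD; first apply: degree_ltD.
  - exact: (degree_lt_symbolM [:: a]).
  - exact: (@degree_ltM _ 0) (degree_lt_nat _ _ _) IH1.
  rewrite -mulrA; apply: (degree_lt_symbolM [:: _]).
  exact: (@degree_ltM _ 0) (degree_lt_nat _ _ _) IH2.
elim: s sd => [_|w s IHs].
  by rewrite big_nil (raddf0 (@at_infinity k)); exact: degree_lt0.
rewrite [all _ _]/= => /andP[wd sd]; rewrite big_cons (raddfD (@at_infinity k)).
apply: degree_ltD; last exact: IHs.
by apply: degree_ltW (Hw w).2; case: d wd {sd IHs}.
Qed.

(** Multiplying by generic units loses no information: for r = 1 and w = (t), y is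
    the residue at infinity of y \{t}. The subtraction is truncated, so that for
    d <= r the conclusion is y = 0. *)
Lemma degree_lt_words r d k (y : milnorK2 k) :
  (forall l (i : {rmorphism k -> l}) w, size w = r ->
     degree_lt d (milnorK2_map i y * symbol w)) -> degree_lt (d - r) y.
Proof.
elim: r k y => [|r IHr] k y yd.
  by have := yd k idfun [::] erefl; rewrite milnorK2_map_id symbol_nil mulr1 subn0.
rewrite subnS.
have : degree_lt (d - r) (milnorK2_map (ratfun_const k) y * \{ratfun_X k}).
  apply: IHr => l i w wr.
  have := yd _ (i \o ratfun_const k) (kunits_map i (ratfun_X k) :: w).
  rewrite /= wr => /(_ erefl); rewrite (symbol_cons (kunits_map _ _)) mulrA.
  by rewrite -(@milnorK2_map_comp _ _ _ (ratfun_const k) i) // milnorK2_mapM milnorK2_map_symbol1.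
move/degree_lt_residue; by rewrite at_infinity_mulX.
Qed.

End DegreeFiltration.

(** * Families indexed by words, and derivatives of operations *)

Section WordFamilies.

(** The properties of the families (a_1, ..., a_r) |-> y \{a_1, ..., a_r} that
    characterize them, see [word_family_symbol]. *)
Record word_family (r : nat) (k : fieldType)
    (F : forall l : fieldType, {rmorphism k -> l} -> seq (kunits l) -> milnorK2 l) : Prop := {
  wf_natural : forall (l m : fieldType) (i : {rmorphism k -> l})
    (j : {rmorphism k -> m}) (f : {rmorphism l -> m}), (forall a, f (i a) = j a) ->
    forall w, size w = r -> F m j (map (kunits_map f) w) = milnorK2_map f (F l i w);
  wf_symbol : forall (l : fieldType) (i : {rmorphism k -> l}) v w,
    size v = r -> [seq \{a} | a <- v] = [seq \{a} | a <- w] -> F l i v = F l i w;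
  wf_one : forall (l : fieldType) (i : {rmorphism k -> l}) w,
    size w = r -> kone l \in w -> F l i w = 0
}.

(** The case d = 0 of [degree_lt_words]. *)
Lemma words_inj r k (y z : milnorK2 k) :
  (forall (l : fieldType) (i : {rmorphism k -> l}) w, size w = r ->
     milnorK2_map i y * symbol w = milnorK2_map i z * symbol w) -> y = z.
Proof.
move=> yz; apply: milnorK2_add_eq0; apply: degree_lt0_eq0.
apply: (@degree_lt_words r 0) => l i w wr.
rewrite milnorK2_mapD mulrDl [X in X + _](yz l i w wr) milnorK2_addxx.
exact: degree_lt0.
Qed.

Lemma kunits_map_comp (k l m : fieldType) (f : {rmorphism k -> l})
    (g : {rmorphism l -> m}) (h : {rmorphism k -> m}) :
  (forall a, g (f a) = h a) -> forall a, kunits_map g (kunits_map f a) = kunits_map h a.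
Proof. by move=> gfh a; apply: val_inj; rewrite /= gfh. Qed.

Lemma kunits_map_id (k : fieldType) (a : kunits k) : kunits_map idfun a = a.
Proof. exact: val_inj. Qed.

(** For a fixed first entry a, the induction hypothesis over the field of a gives a
    coefficient D(a), unique by [words_inj]. Uniqueness makes a |-> D(a) natural and
    dependent on \{a} only, so D(a) = y0 + y1 \{a}; and y0 = D(1) = 0. *)
Lemma word_family_symbol r k F : word_family r F ->
  exists y : milnorK2 k, forall (l : fieldType) (i : {rmorphism k -> l}) w, size w = r ->
    F l i w = milnorK2_map i y * symbol w.
Proof.
elim: r k F => [|r IHr] k F [Fnat Fsym F1].
  exists (F k idfun [::]) => l i [|//] _.
  by rewrite symbol_nil mulr1 -(Fnat k l idfun i i).
have Feq (l : fieldType) (i j : {rmorphism k -> l}) w :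
    i =1 j -> size w = r.+1 -> F l i w = F l j w.
  move=> ij wr; rewrite -[LHS]milnorK2_map_id -(Fnat _ _ i j idfun) //.
  by congr (F _ _ _); rewrite -[RHS]map_id; apply: eq_map => a; rewrite kunits_map_id.
have D_ex (l : fieldType) (i : {rmorphism k -> l}) a : exists y : milnorK2 l,
    forall (m : fieldType) (j : {rmorphism l -> m}) (h : {rmorphism k -> m}) w,
    (forall b, j (i b) = h b) -> size w = r ->
    F m h (kunits_map j a :: w) = milnorK2_map j y * symbol w.
  have [|y yP] := IHr l (fun m j w => F m (j \o i) (kunits_map j a :: w)).
    split=> [m n j h f fjh w wr|m j v w vr vw|m j w wr w1].
    - rewrite -(@Fnat _ _ (j \o i) (h \o i) f) /= ?wr //.
      by rewrite (kunits_map_comp fjh).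
    - by apply: Fsym; rewrite /= ?vr // vw.
    - by apply: F1; rewrite ?inE ?w1 ?orbT //= wr.
  exists y => m j h w jih wr; rewrite -yP //.
  by apply: Feq => [b|]; rewrite /= ?jih ?wr.
pose D (l : fieldType) (i : {rmorphism k -> l}) a := projT1 (cid (D_ex l i a)).
have DP (l : fieldType) (i : {rmorphism k -> l}) a : forall (m : fieldType) (j : {rmorphism l -> m})
    (h : {rmorphism k -> m}) w, (forall b, j (i b) = h b) -> size w = r ->
    F m h (kunits_map j a :: w) = milnorK2_map j (D l i a) * symbol w.
  exact: projT2 (cid (D_ex l i a)).
have [||y0 [y1 yP]] := @unit_family_affine k D.
- move=> l m i j f fij a; apply: (@words_inj r) => n h w wr.
  rewrite (@milnorK2_map_comp _ _ _ f h (h \o f)) //.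
  rewrite -[LHS](DP m j _ n h (h \o j)) // -[RHS](DP l i a n (h \o f) (h \o j)) //=; last first.
    by move=> b; rewrite /= fij.
  by rewrite (@kunits_map_comp _ _ _ f h (h \o f)).
- move=> l i a b ab; apply: (@words_inj r) => n h w wr.
  rewrite -[LHS](DP l i a n h (h \o i)) // -[RHS](DP l i b n h (h \o i)) //.
  apply: Fsym; rewrite /= ?wr //.
  by rewrite -!milnorK2_map_symbol1 ab.
have y0_eq0 : y0 = 0.
  have := yP k idfun (kone k); rewrite symbol_kone mulr0 addr0 milnorK2_map_id => <-.
  apply: (@words_inj r) => l i w wr.
  rewrite milnorK2_map0 [RHS]mul0r -[LHS](DP k idfun _ l i i) //.
  apply: F1; rewrite /= ?wr //.
  by rewrite inE; apply/orP; left; apply/eqP; apply: val_inj; rewrite /= rmorph1.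
exists y1 => l i [|a w] //= [wr].
rewrite -[a in F _ _ (a :: _)]kunits_map_id (DP l i a l idfun i) //.
by rewrite milnorK2_map_id yP y0_eq0 milnorK2_map0 add0r (symbol_cons a w) mulrA.
Qed.

End WordFamilies.

Section Derivative.
Variables (k0 : fieldType) (i : nat).

Lemma homogeneous_add_symbol (k : fieldType) (x : milnorK2n k i) (w : seq (kunits k)) :
  size w = i -> val x + symbol w \in @homogeneous k i.
Proof.
move=> /eqP wi; have [s xE] := homogeneousP x.
by apply/asboolP; exists (Tuple wi :: s); rewrite big_cons -xE addrC.
Qed.

Definition add_symbol (k : fieldType) (x : milnorK2n k i) (w : seq (kunits k)) : milnorK2n k i :=
  insubd x (val x + symbol w).

Lemma add_symbolE (k : fieldType) (x : milnorK2n k i) (w : seq (kunits k)) :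
  size w = i -> val (add_symbol x w) = val x + symbol w.
Proof. by move=> wi; rewrite insubdK //; exact: homogeneous_add_symbol. Qed.

Lemma add_symbol_map (k l : fieldType) (f : {rmorphism k -> l}) (x : milnorK2n k i) w :
  size w = i ->
  milnorK2n_map f (add_symbol x w) = add_symbol (milnorK2n_map f x) (map (kunits_map f) w).
Proof.
move=> wi; apply: val_inj; rewrite add_symbolE ?size_map //.
rewrite [LHS](congr1 (milnorK2_map f) (add_symbolE x wi)).
by rewrite milnorK2_mapD milnorK2_map_symbol.
Qed.

Lemma milnorK2n_map_comp (k l m : fieldType) (f : {rmorphism k -> l})
    (g : {rmorphism l -> m}) (h : {rmorphism k -> m}) :
  (forall a, g (f a) = h a) ->
  forall x : milnorK2n k i, milnorK2n_map g (milnorK2n_map f x) = milnorK2n_map h x.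
Proof. by move=> gfh x; apply: val_inj; exact: milnorK2_map_comp. Qed.

Lemma milnorK2n_map_id (k : fieldType) (x : milnorK2n k i) : milnorK2n_map idfun x = x.
Proof. by apply: val_inj; exact: milnorK2_map_id. Qed.

Lemma symbol_eq_map (k : fieldType) (v w : seq (kunits k)) :
  [seq \{a} | a <- v] = [seq \{a} | a <- w] -> symbol v = symbol w.
Proof.
elim: v w => [|a v IHv] [|b w] // [ab /IHv vw].
by rewrite (symbol_cons a v) (symbol_cons b w) ab vw.
Qed.

Lemma symbol_has_one (k : fieldType) (w : seq (kunits k)) : kone k \in w -> symbol w = 0.
Proof.
elim: w => // a w IHw; rewrite inE (symbol_cons a w) => /orP[/eqP <-|/IHw ->].
  by rewrite symbol_kone mul0r.
by rewrite mulr0.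
Qed.

Variable phi : operation k0 i.

(** The base field is enlarged to k, so that x becomes a constant, and
    [word_family_symbol] is applied to w |-> phi(x + w) - phi(x). *)
Lemma derivative_pointwise (k : fieldType) (ik : {rmorphism k0 -> k}) (x : milnorK2n k i) :
  exists y : milnorK2 k, forall (l : fieldType) (j : {rmorphism k -> l})
    (il : {rmorphism k0 -> l}), (forall a, j (ik a) = il a) ->
  forall w, size w = i -> phi l il (add_symbol (milnorK2n_map j x) w) =
    phi l il (milnorK2n_map j x) + milnorK2_map j y * symbol w.
Proof.
have Feq (l : fieldType) (g h : {rmorphism k0 -> l}) z : g =1 h -> phi l g z = phi l h z.
  move=> gh; rewrite -[phi l g z]milnorK2_map_id -(op_natural phi (ik := g) (il := h)) //.
  by rewrite milnorK2n_map_id.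
pose F (l : fieldType) (j : {rmorphism k -> l}) w :=
  phi l (j \o ik) (add_symbol (milnorK2n_map j x) w) + phi l (j \o ik) (milnorK2n_map j x).
have [|y yP] := @word_family_symbol i k F.
  split=> [l m j h f fjh w wi|l j v w vi vw|l j w wi w1].
  - have fE a : f ((j \o ik) a) = (h \o ik) a by rewrite /= fjh.
    rewrite /F milnorK2_mapD -!(op_natural phi fE) add_symbol_map //.
    by rewrite (milnorK2n_map_comp fjh).
  - rewrite /F; congr (phi _ _ _ + _); apply: val_inj.
    rewrite !add_symbolE ?(symbol_eq_map vw) //.
    by rewrite -(size_map (fun a => \{a}) w) -vw size_map.
  - rewrite /F (_ : add_symbol _ _ = milnorK2n_map j x) ?milnorK2_addxx //.
    by apply: val_inj; rewrite add_symbolE // symbol_has_one // addr0.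
exists y => l j il jE w wi; rewrite -(yP l j w wi) /F addrC.
rewrite !(Feq _ (j \o ik) il) //.
by rewrite -addrA milnorK2_addxx addr0.
Qed.

End Derivative.

Section TaylorExpansion.
Variables (k0 : fieldType) (i : nat).
Implicit Type phi : operation k0 i.

(** The coefficients of [derivative_pointwise] are unique, hence natural. *)
Lemma derivative_ex phi : exists phi' : operation k0 i,
  forall (k : fieldType) (ik : {rmorphism k0 -> k}) (x x' : milnorK2n k i) w,
    size w = i -> val x' = val x + symbol w ->
    phi k ik x' = phi k ik x + phi' k ik x * symbol w.
Proof.
pose D (k : fieldType) (ik : {rmorphism k0 -> k}) (x : milnorK2n k i) :=
  projT1 (cid (derivative_pointwise phi ik x)).
have DP (k : fieldType) (ik : {rmorphism k0 -> k}) (x : milnorK2n k i) :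
    forall (l : fieldType) (j : {rmorphism k -> l}) (il : {rmorphism k0 -> l}),
    (forall a, j (ik a) = il a) -> forall w, size w = i ->
    phi l il (add_symbol (milnorK2n_map j x) w) =
      phi l il (milnorK2n_map j x) + milnorK2_map j (D k ik x) * symbol w.
  exact: projT2 (cid (derivative_pointwise phi ik x)).
have D_natural : natural_op D.
  move=> k l ik il f fE x; apply: (@words_inj i) => m h w wi.
  pose im : {rmorphism k0 -> m} := h \o il.
  apply: (addrI (phi m im (milnorK2n_map h (milnorK2n_map f x)))).
  apply: etrans (esym (DP l il _ m h im (fun a => erefl) w wi)) _.
  have hfE a : (h \o f) (ik a) = im a by rewrite /= fE.
  rewrite (milnorK2_map_comp (h := h \o f)) // (milnorK2n_map_comp (h := h \o f)) //.
  exact: DP.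
exists (Operation D_natural) => k ik x x' w wi x'E /=.
have := DP k ik x k idfun ik (fun a => erefl) w wi.
rewrite milnorK2n_map_id milnorK2_map_id => <-; congr (phi k ik _).
by apply: val_inj; rewrite add_symbolE.
Qed.

Definition derivative phi : operation k0 i := projT1 (cid (derivative_ex phi)).

Lemma derivativeE phi (k : fieldType) (ik : {rmorphism k0 -> k}) (x x' : milnorK2n k i) w :
  size w = i -> val x' = val x + symbol w ->
  phi k ik x' = phi k ik x + derivative phi k ik x * symbol w.
Proof. exact: (projT2 (cid (derivative_ex phi)) k ik x x' w). Qed.

Lemma homogeneous_sum (k : fieldType) (s : seq (i.-tuple (kunits k))) :
  \sum_(w <- s) symbol w \in @homogeneous k i.
Proof. by apply/asboolP; exists s. Qed.

Definition symbol_sum (k : fieldType) (s : seq (i.-tuple (kunits k))) : milnorK2n k i :=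
  exist (fun x => x \in @homogeneous k i) _ (homogeneous_sum s).

Lemma op_symbol_nil phi (k : fieldType) (ik : {rmorphism k0 -> k}) :
  phi k ik (symbol_sum [::]) = milnorK2_map ik (phi k0 idfun (symbol_sum [::])).
Proof.
rewrite -(op_natural phi (il := ik)) //; congr (phi k ik _); apply: val_inj.
by rewrite /= !big_nil milnorK2_map0.
Qed.

Definition taylor phi n : milnorK2 k0 := iter n derivative phi k0 idfun (symbol_sum [::]).

(** The generating polynomial of the divided powers of the sum of s. *)
Definition gamma_poly (k : fieldType) (s : seq (i.-tuple (kunits k))) : {poly milnorK2 k} :=
  \prod_(w <- s) (1 + symbol w *: 'X).

Lemma gamma_polyE (k : fieldType) (s : seq (i.-tuple (kunits k))) n :
  gamma_sum n s = (gamma_poly s)`_n.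
Proof.
rewrite /gamma_sum /elem_sum /gamma_poly; set t := map _ s.
rewrite -(big_map (fun w : i.-tuple (kunits k) => symbol w) xpredT (fun c => 1 + c *: 'X)).
rewrite (big_nth 0) big_mkord -/t.
under [in RHS]eq_bigr do rewrite addrC.
rewrite (bigA_distr _ _ (fun l : 'I_(size t) => t`_l *: 'X) (fun => 1)) coef_sum big_mkcond /=.
apply: eq_bigr => L _; rewrite -big_mkcond /=.
under [in RHS]eq_bigr do rewrite -mul_polyC.
rewrite big_split /= prodr_const -rmorph_prod coefCM coefXn eq_sym.
by case: eqP => _; rewrite ?mulr1 ?mulr0.
Qed.

Lemma gamma_sum0 (k : fieldType) (s : seq (i.-tuple (kunits k))) : gamma_sum 0 s = 1.
Proof. exact: elem_sum0. Qed.

Lemma gamma_sum_cons (k : fieldType) w (s : seq (i.-tuple (kunits k))) n :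
  gamma_sum n.+1 (w :: s) = gamma_sum n.+1 s + symbol w * gamma_sum n s.
Proof.
by rewrite !gamma_polyE /gamma_poly big_cons mulrDl mul1r coefD -scalerAl coefZ coefXM.
Qed.

Lemma gamma_sum_eq0 (k : fieldType) (s : seq (i.-tuple (kunits k))) n :
  (size s < n)%N -> gamma_sum n s = 0.
Proof.
elim: s n => [|w s IHs] [|n] //=; last first.
  by rewrite ltnS gamma_sum_cons => sn; rewrite !IHs ?mulr0 ?addr0 // ltnS ltnW.
by rewrite gamma_polyE /gamma_poly big_nil coef1.
Qed.

Lemma gamma_sum_all (k : fieldType) (s : seq (i.-tuple (kunits k))) :
  gamma_sum (size s) s = symbol (flatten [seq val w | w <- s]).
Proof.
elim: s => [|w s IHs]; first by rewrite gamma_sum0 symbol_nil.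
by rewrite /= gamma_sum_cons gamma_sum_eq0 // add0r IHs symbol_cat.
Qed.

Lemma taylor_expansion phi (k : fieldType) (ik : {rmorphism k0 -> k})
    (x : milnorK2n k i) (s : seq (i.-tuple (kunits k))) :
  val x = \sum_(w <- s) symbol w ->
  phi k ik x = \sum_(n < (size s).+1) milnorK2_map ik (taylor phi n) * gamma_sum n s.
Proof.
move=> xs; have {x xs} -> : x = symbol_sum s by exact: val_inj.
elim: s phi => [|w s IHs] phi.
  by rewrite op_symbol_nil big_ord1 gamma_sum0 mulr1.
rewrite (@derivativeE phi k ik (symbol_sum s) _ w) ?size_tuple //; last first.
  by rewrite /= big_cons addrC.
rewrite !IHs [RHS]big_ord_recl gamma_sum0.
under [in RHS]eq_bigr => n _ do rewrite gamma_sum_cons mulrDr.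
rewrite big_split addrA /=; congr (_ + _); last first.
  rewrite mulr_suml; apply: eq_bigr => n _.
  by rewrite /taylor -iterSr -mulrA [_ * symbol w]mulrC.
rewrite big_ord_recl gamma_sum0; congr (_ + _).
rewrite [RHS]big_ord_recr [X in _ = _ + X](_ : _ = 0); first by rewrite addr0.
by rewrite gamma_sum_eq0 ?mulr0.
Qed.

Lemma symbol_sqr_word (k : fieldType) (w : seq (kunits k)) :
  symbol w * symbol w = \{kunits_N1 k} ^+ size w * symbol w.
Proof.
elim: w => [|a w IHw]; first by rewrite symbol_nil.
by rewrite (symbol_cons a w) mulrACA symbol_sqr IHw mulrACA exprS.
Qed.

(** The symbols of (a, w) and (b, w) add up to a single symbol, along which phi is
    affine; so the second-order term of phi along the two of them vanishes. *)
Lemma derivative2_sum phi (l : fieldType) (j : {rmorphism k0 -> l}) a b (w : seq (kunits l)) :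
  (size w).+1 = i -> let x0 := symbol_sum [::] in
  derivative (derivative phi) l j x0 * (symbol (a :: w) * symbol (b :: w)) = 0.
Proof.
move=> wi x0; pose c := kmul a b.
have abc : symbol (c :: w) = symbol (a :: w) + symbol (b :: w).
  by rewrite (symbol_cons c w) (symbol_cons a w) (symbol_cons b w) symbol_kmul mulrDl.
have x0E : val x0 = 0 by rewrite /= big_nil.
pose xb := add_symbol x0 (b :: w); pose xc := add_symbol x0 (c :: w).
have xbE : val xb = val x0 + symbol (b :: w) by rewrite add_symbolE.
have xcE : val xc = val x0 + symbol (c :: w) by rewrite add_symbolE.
have xcE' : val xc = val xb + symbol (a :: w).
  by rewrite xcE xbE abc -addrA [symbol (b :: w) + _]addrC.
have := derivativeE (w := a :: w) phi j wi xcE'.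
rewrite [LHS](derivativeE (w := c :: w) phi j wi xcE).
rewrite (derivativeE (w := b :: w) phi j wi xbE).
rewrite (derivativeE (w := b :: w) (derivative phi) j wi xbE).
rewrite abc mulrDr mulrDl.
move: (derivative (derivative phi) l j x0) (derivative phi l j x0) => u v.
rewrite -[LHS]addr0 (addrC (v * symbol (a :: w))) -!addrA => /addrI/addrI/addrI E.
by rewrite [symbol (a :: w) * _]mulrC mulrA -E.
Qed.

(** In [derivative2_sum] the product of the two symbols is that of (a, b, w) times
    \{-1}^(i-1), and a, b, w can be generic. *)
Lemma tau_taylor phi n : (2 <= n)%N -> (0 < i)%N -> tau i (taylor phi n) = 0.
Proof.
case: n => [|[|n]] // _ i_gt0; rewrite /taylor 2!iterS.
move: {phi}(iter n derivative phi) => phi.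
set D := derivative (derivative phi) k0 idfun (symbol_sum [::]).
apply: (@words_inj i.+1) => l j [|a [|b w]] wi; [discriminate | case: wi => wi ..].
  by exfalso; move: i_gt0; rewrite -wi.
rewrite milnorK2_map0 [RHS]mul0r -[RHS](derivative2_sum phi j a b wi).
rewrite op_symbol_nil -/D /tau milnorK2_mapM rmorphXn /= milnorK2_map_symbol1 kunits_map_N1.
rewrite -[in X in X * symbol _]wi [_.+1.-1]/=.
rewrite (symbol_cons a (b :: w)) (symbol_cons a w) (symbol_cons b w).
rewrite [in RHS]mulrACA symbol_sqr_word.
ring.
Qed.

End TaylorExpansion.

(** * Independence of the decomposition into symbols *)

Lemma mulr_intlr (R : pzRingType) (m n : int) (a g b : R) :
  m%:~R * a * g * (n%:~R * b) = a * g * b *~ m *~ n.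
Proof. by rewrite !mulrzl !mulrzAl mulrzAr -!mulrzA mulrC. Qed.

Section Presentation.
Variables (k : fieldType) (N : free_ring k -> Prop).
Hypothesis N0 : N 0.
Hypothesis NB : forall x y, N x -> N y -> N (x - y).
Hypothesis N2 : forall x, N (x + x).
Hypothesis N_rel : forall u g v, milnor_rel g -> N (word u * g * word v).

Let ND x y : N x -> N y -> N (x + y).
Proof. by move=> Nx Ny; rewrite -[y]opprK -(sub0r y); do 2?apply: NB. Qed.

Let NMz x n : N x -> N (x *~ n).
Proof.
move=> Nx; have NMn m : N (x *+ m).
  by elim: m => [|m IHm]; rewrite ?mulr0n // mulrS; apply: ND.
by case: n => n; [exact: NMn | rewrite NegzE mulrNz -sub0r; apply: NB; last exact: NMn].
Qed.

Let N_ideal z : ideal_gen (@milnor_rel k) z -> N z.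
Proof.
elim=> [|x y _ Nx _ Ny|a g b gR] //; first exact: NB.
rewrite [a]free_ringE [b]free_ringE mulr_suml mulr_suml.
elim/big_ind: _ => // m _; rewrite mulr_sumr.
elim/big_ind: _ => // n _.
rewrite [X in N X]mulr_intlr; do 2!apply: NMz; exact: N_rel.
Qed.

(** An induction principle for the kernel of the projection from the free ring, as an
    additive group: doubles and the relations multiplied by words on both sides
    generate it. *)
Lemma milnorK2_kernel z : mod2 (to_milnorK z) = 0 -> N z.
Proof.
have toB x y : to_milnorK (x - y) = to_milnorK x - to_milnorK y by exact: raddfB.
have toD x y : to_milnorK (x + y) = to_milnorK x + to_milnorK y by exact: raddfD.
have toM x y : to_milnorK (x * y) = to_milnorK x * to_milnorK y by exact: rmorphM.
have Nker x : to_milnorK x = 0 -> N x.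
  move/eqP; rewrite -(raddf0 (@to_milnorK k)) [_ == _]ringquot_projE subr0.
  by move/in_idealP/N_ideal.
move/eqP; rewrite -(raddf0 (@mod2 k)) [_ == _]ringquot_projE subr0 => /in_idealP xI.
 have [x zx] : exists x, to_milnorK z = x by exists (to_milnorK z).
rewrite zx in xI; move: xI z zx.
have to_ex (x' : milnorK k) : exists z', to_milnorK z' = x'.
  by exists (ringquot_repr x'); exact: ringquot_reprK.
have Neq z z' : N z' -> to_milnorK z = to_milnorK z' -> N z.
  move=> Nz' zz'; rewrite -(subrK z' z); apply: ND => //; apply: Nker.
  by rewrite toB zz' subrr.
elim=> [|{}x y _ IHx _ IHy|a g b ->] z zx; first exact: Nker.
  have [u ux] := to_ex x; have [v vy] := to_ex y.
  apply: (Neq _ (u - v)); first by apply: NB; [exact: IHx | exact: IHy].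
  by rewrite toB ux vy.
have [u ua] := to_ex a; have [v vb] := to_ex b.
apply: (Neq _ (u * v + u * v)); first exact: N2.
rewrite toD toM ua vb zx.
by rewrite mulr_natr -mulr_natl -mulrA mulr_natl mulr2n.
Qed.

End Presentation.

Lemma linear_mul (R : comNzRingType) (c d : R) :
  (1 + c *: 'X) * (1 + d *: 'X) = 1 + (c + d) *: 'X + (c * d) *: 'X^2.
Proof. by rewrite -!mul_polyC polyCM polyCD; ring. Qed.

Section WellDefined.
Variables (k : fieldType) (i : nat) (y : milnorK2 k).
Hypothesis i_gt0 : (0 < i)%N.
Hypothesis y_tau : \{kunits_N1 k} ^+ i.-1 * y = 0.

(* Equality modulo the annihilator of y. *)
Local Notation "p =y q" := (y *: p = y *: q) (at level 70).
Implicit Types (p q : {poly milnorK2 k}) (w : seq (kunits k)) (z : free_ring k).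

Let eqyM p q p' q' : p =y q -> p' =y q' -> p * p' =y q * q'.
Proof. by move=> pq pq'; rewrite scalerAl pq -scalerAl scalerAr pq' -scalerAr. Qed.

Definition gamma_factor w : {poly milnorK2 k} :=
  if size w == i then 1 + symbol w *: 'X else 1.

Lemma y_symbol_sqr w : size w = i -> y * (symbol w * symbol w) = 0.
Proof.
move=> wi; rewrite symbol_sqr_word wi -(prednK i_gt0) exprS.
rewrite (_ : _ * _ = \{kunits_N1 k} * symbol w * (\{kunits_N1 k} ^+ i.-1 * y)); last by ring.
by rewrite y_tau mulr0.
Qed.

Lemma sqr_linear (c : milnorK2 k) : (1 + c *: 'X) * (1 + c *: 'X) = 1 + (c * c) *: 'X^2.
Proof.
by rewrite linear_mul milnorK2_addxx scale0r addr0.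
Qed.

Lemma gamma_factor_sqr w : gamma_factor w * gamma_factor w =y 1.
Proof.
rewrite /gamma_factor; case: eqP => wi; last by rewrite mulr1.
by rewrite sqr_linear scalerDr scalerA y_symbol_sqr // scale0r addr0.
Qed.

Lemma odd_abszD (m n : int) : odd (absz (m + n)) = odd (absz m) (+) odd (absz n).
Proof. lia. Qed.

(** Extends w |-> gamma_factor w from words to the free ring: modulo the annihilator
    of y it turns sums into products. Factors are involutions there, hence only the
    parity of a coefficient counts, and no inverse is needed. *)
Definition gamma_prod z := \prod_(m <- msupp z) gamma_factor (fmonom_val m) ^+ odd `|z@_m|%N.

Lemma gamma_prodEw (d : {fset {fmonom (kunits k)}}) z : (msupp z `<=` d)%fset ->
  gamma_prod z = \prod_(m <- d) gamma_factor (fmonom_val m) ^+ odd `|z@_m|%N.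
Proof.
move=> zd; apply: big_fset_incl => // m _ mz.
by rewrite mcoeff_outdom.
Qed.

Lemma gamma_prodD z z' : gamma_prod (z + z') =y gamma_prod z * gamma_prod z'.
Proof.
pose d := (msupp z `|` msupp z')%fset.
rewrite (@gamma_prodEw d) ?msuppD_le // (@gamma_prodEw d z) ?fsubsetUl //.
rewrite (@gamma_prodEw d z') ?fsubsetUr //.
rewrite -big_split /=.
elim/big_rec2: _ => // m p q _ pq; apply: eqyM => //.
rewrite mcoeffD odd_abszD; case: odd; case: odd; rewrite /= ?mulr1 ?mul1r //.
by rewrite gamma_factor_sqr.
Qed.

Lemma gamma_prodN z : gamma_prod (- z) = gamma_prod z.
Proof.
by rewrite /gamma_prod msuppN; apply: eq_bigr => m _; rewrite mcoeffN abszN.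
Qed.

Lemma gamma_prod_word w : gamma_prod (word w) = gamma_factor w.
Proof.
by rewrite wordE (@gamma_prodEw [fset FMonom w]%fset) ?msuppU_le // big_seq_fset1 mcoeffUU.
Qed.

Lemma gamma_prod_double z : gamma_prod (z + z) = 1.
Proof. by apply: big1 => m _; rewrite mcoeffD odd_abszD addbb. Qed.

(** For a relation \{c} = \{a} + \{b} between words with common remaining letters S of
    length i - 1, the term A B of (1 + A X)(1 + B X) is \{a} \{b} S^2, a multiple of
    \{-1}^(i-1) which y kills. *)
Lemma gamma_prod_kernel z : mod2 (to_milnorK z) = 0 -> gamma_prod z =y 1.
Proof.
move: z; apply: milnorK2_kernel.
- by rewrite /gamma_prod msupp0 big_seq_fset0.
- by move=> z z' zN zN'; rewrite gamma_prodD gamma_prodN -[in RHS](mulr1 1); apply: eqyM.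
- by move=> z; rewrite gamma_prod_double.
move=> u g v [a b c abc|n w r s rs ars]; last first.
  have w0 : symbol w = 0 :> milnorK2 k.
    rewrite -[RHS](raddf0 (@mod2 k)); congr mod2.
    by apply: ringquot_proj_gen; apply: milnor_rel_steinberg rs ars.
  rewrite -!word_cat gamma_prod_word /gamma_factor !symbol_cat w0 mulr0 mul0r scale0r addr0.
  by rewrite if_same.
rewrite mulrBr mulrDr mulrBl mulrDl -!word_cat.
have sz d : size ((u ++ [:: d]) ++ v) = (size u + (size v).+1)%N.
  by rewrite !size_cat /= addn1 addSnnS.
rewrite gamma_prodD gamma_prodN.
transitivity (y *: (gamma_factor ((u ++ [:: c]) ++ v) *
  (gamma_factor ((u ++ [:: a]) ++ v) * gamma_factor ((u ++ [:: b]) ++ v)))).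
  apply: eqyM; first by rewrite gamma_prod_word.
  by rewrite gamma_prodD !gamma_prod_word.
rewrite /gamma_factor !sz; case: eqP => uvi; last by rewrite !mulr1.
have sE d : symbol ((u ++ [:: d]) ++ v) = \{d} * symbol (u ++ v).
  by rewrite !symbol_cat [symbol u * _]mulrC mulrA.
rewrite !sE (symbol1M abc) [(\{a} + _) * _]mulrDl.
have S2 : y * (symbol (u ++ v) * symbol (u ++ v)) = 0.
  have uvi' : size (u ++ v) = i.-1 by rewrite size_cat -uvi addnS.
  by rewrite symbol_sqr_word uvi' mulrA [y * _]mulrC y_tau mul0r.
set A := \{a} * _; set B := \{b} * _.
have AB : (1 + A *: 'X) * (1 + B *: 'X) =y 1 + (A + B) *: 'X.
  rewrite linear_mul scalerDr scalerA (_ : y * (A * B) = 0) ?scale0r ?addr0 //.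
  by rewrite /A /B mulrACA [y * _]mulrCA S2 mulr0.
transitivity (y *: ((1 + (A + B) *: 'X) * (1 + (A + B) *: 'X))); first exact: eqyM.
rewrite sqr_linear scalerDr scalerA (_ : y * _ = 0) ?scale0r ?addr0 //.
have -> : (A + B) * (A + B) = (\{a} + \{b}) * (\{a} + \{b}) * (symbol (u ++ v) * symbol (u ++ v)).
  by rewrite /A /B -mulrDl mulrACA.
by rewrite [y * _]mulrCA S2 mulr0.
Qed.

Definition word_sum (s : seq (i.-tuple (kunits k))) : free_ring k := \sum_(w <- s) word w.

Lemma word_sumE s : mod2 (to_milnorK (word_sum s)) = \sum_(w <- s) symbol w.
Proof.
by rewrite /word_sum (raddf_sum (@to_milnorK k)) (raddf_sum (@mod2 k)).
Qed.

Lemma gamma_prod_word_sum s : gamma_prod (word_sum s) =y gamma_poly s.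
Proof.
rewrite /word_sum /gamma_poly; elim: s => [|w s IHs].
  by rewrite !big_nil /gamma_prod msupp0 big_seq_fset0.
rewrite !big_cons gamma_prodD; apply: eqyM => //.
by rewrite gamma_prod_word /gamma_factor size_tuple eqxx.
Qed.

Lemma gamma_sum_unique n (s t : seq (i.-tuple (kunits k))) :
  \sum_(w <- s) symbol w = \sum_(w <- t) symbol w ->
  y * gamma_sum n s = y * gamma_sum n t.
Proof.
move=> st; rewrite !gamma_polyE -!coefZ.
suff -> : gamma_poly s =y gamma_poly t by [].
have st0 : mod2 (to_milnorK (word_sum s - word_sum t)) = 0.
  have -> : mod2 (to_milnorK (word_sum s - word_sum t)) =
      mod2 (to_milnorK (word_sum s)) - mod2 (to_milnorK (word_sum t)).
    exact: (raddfB (@mod2 k \o @to_milnorK k)).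
  rewrite !word_sumE.
  by apply/eqP; rewrite subr_eq0; apply/eqP.
have st1 : gamma_prod (word_sum s) * gamma_prod (word_sum t) =y 1.
  by rewrite -(gamma_prod_kernel st0) gamma_prodD gamma_prodN.
have tt1 : gamma_prod (word_sum t) * gamma_prod (word_sum t) =y 1.
  by rewrite -gamma_prodD gamma_prod_double.
rewrite -gamma_prod_word_sum -[RHS]gamma_prod_word_sum.
have E1 : gamma_prod (word_sum s) * (gamma_prod (word_sum t) * gamma_prod (word_sum t)) =y
    gamma_prod (word_sum s) * 1.
  exact: eqyM.
rewrite -[gamma_prod (word_sum s)]mulr1 -E1 mulrA -[gamma_prod (word_sum t) in RHS]mul1r.
exact: eqyM.
Qed.

End WellDefined.

(** * Series of divided powers *)

Lemma big_uniq_eq (T : eqType) (V : nmodType) (r t : seq T) (F : T -> V) :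
  uniq r -> uniq t -> (forall x, x \in r -> x \notin t -> F x = 0) ->
  (forall x, x \in t -> x \notin r -> F x = 0) -> \sum_(x <- r) F x = \sum_(x <- t) F x.
Proof.
have H (r' t' : seq T) : (forall x, x \in r' -> x \notin t' -> F x = 0) ->
    \sum_(x <- r') F x = \sum_(x <- [seq x <- r' | x \in t']) F x.
  move=> Fr; rewrite big_filter [RHS]big_mkcond /= !big_seq; apply: eq_bigr => x xr.
  by case: ifPn => // /(Fr _ xr).
move=> ur ut Fr Ft; rewrite (H r t) // (H t r) //; apply: perm_big.
by apply: uniq_perm; rewrite ?filter_uniq // => x; rewrite !mem_filter andbC.
Qed.

Lemma big_ord_support (V : nmodType) (F : nat -> V) m n :
  (forall j, (m <= j)%N -> F j = 0) -> (forall j, (n <= j)%N -> F j = 0) ->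
  \sum_(j < m) F j = \sum_(j < n) F j.
Proof.
move=> Fm Fn; rewrite -!(big_mkord xpredT F); apply: big_uniq_eq; rewrite ?iota_uniq //.
  by move=> j _; rewrite mem_index_iota /= -leqNgt => /Fn.
by move=> j _; rewrite mem_index_iota /= -leqNgt => /Fm.
Qed.

Lemma big_ord_last_eq (V : zmodType) (F G : nat -> V) n :
  (forall m, (m < n)%N -> F m = G m) -> \sum_(m < n.+1) F m = \sum_(m < n.+1) G m ->
  F n = G n.
Proof.
move=> FG; rewrite !big_ord_recr /=.
by rewrite (eq_bigr (fun m : 'I_n => G m)) => [/addrI|m _]; last exact: FG.
Qed.

Section GammaSeries.
Variables (k0 : fieldType) (i : nat).
Hypothesis i_gt0 : (0 < i)%N.
Implicit Type y : nat -> milnorK2 k0.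

Lemma gamma_sum1 (k : fieldType) (s : seq (i.-tuple (kunits k))) :
  gamma_sum 1 s = \sum_(w <- s) symbol w.
Proof. by rewrite /gamma_sum elem_sum1 big_map. Qed.

Lemma coef_gamma_unique y n (k : fieldType) (ik : {rmorphism k0 -> k})
    (s t : seq (i.-tuple (kunits k))) :
  ker_coefs i y -> \sum_(w <- s) symbol w = \sum_(w <- t) symbol w ->
  milnorK2_map ik (y n) * gamma_sum n s = milnorK2_map ik (y n) * gamma_sum n t.
Proof.
move=> y_ker st; case: n => [|[|n]]; first by rewrite !gamma_sum0.
  by rewrite !gamma_sum1 st.
apply: gamma_sum_unique => //.
have := congr1 (milnorK2_map ik) (y_ker n.+2 isT).
by rewrite /tau milnorK2_map0 milnorK2_mapM rmorphXn /= milnorK2_map_symbol1 kunits_map_N1.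
Qed.

Lemma gamma_seriesE y (k : fieldType) (ik : {rmorphism k0 -> k}) (x : milnorK2n k i)
    (s : seq (i.-tuple (kunits k))) :
  ker_coefs i y -> val x = \sum_(w <- s) symbol w ->
  gamma_series y ik x = \sum_(n < (size s).+1) milnorK2_map ik (y n) * gamma_sum n s.
Proof.
move=> y_ker xs; rewrite /gamma_series /gamma.
have st : \sum_(w <- decomp x) symbol w = \sum_(w <- s) symbol w by rewrite -decompP.
under eq_bigr => n _ do rewrite (coef_gamma_unique n ik y_ker st).
apply: (big_ord_support (F := fun n => milnorK2_map ik (y n) * gamma_sum n s)) => n sn.
  by rewrite -(coef_gamma_unique n ik y_ker st) gamma_sum_eq0 ?mulr0.
by rewrite gamma_sum_eq0 ?mulr0.
Qed.

Lemma tuples_of_word (T : Type) n (w : seq T) : size w = (n * i)%N ->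
  exists2 s : seq (i.-tuple T), size s = n & flatten [seq val t | t <- s] = w.
Proof.
elim: n w => [|n IHn] w wni; first by exists [::] => //; apply/esym/size0nil.
have [|s sn sw] := IHn (drop i w); first by rewrite size_drop wni mulSn addKn.
have ti : size (take i w) == i by rewrite size_takel // wni mulSn leq_addr.
by exists (Tuple ti :: s); rewrite /= ?sn // sw cat_take_drop.
Qed.

(** By strong induction on n: on a sum of n symbols, all terms after the n-th vanish,
    and the n-th one is y n times the symbol of the concatenated word. *)
Lemma gamma_series_inj y z : ker_coefs i y -> ker_coefs i z ->
  (forall (k : fieldType) (ik : {rmorphism k0 -> k}) (x : milnorK2n k i),
     gamma_series y ik x = gamma_series z ik x) -> y = z.
Proof.
move=> y_ker z_ker yz; apply: funext => n; elim/ltn_ind: n => n IHn.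
apply: (@words_inj (n * i)) => l j w /tuples_of_word[s sn sw].
have := yz l j (symbol_sum s).
rewrite (gamma_seriesE (x := symbol_sum s) (s := s) j y_ker erefl).
rewrite (gamma_seriesE (x := symbol_sum s) (s := s) j z_ker erefl).
rewrite sn -sw -[in X in _ -> X]gamma_sum_all sn.
pose F (y' : nat -> milnorK2 k0) m := milnorK2_map j (y' m) * gamma_sum m s.
apply: (@big_ord_last_eq _ (F y) (F z)) => m /IHn yzm.
by rewrite /F yzm.
Qed.

Lemma gamma_sum_map (k l : fieldType) (f : {rmorphism k -> l}) n
    (s : seq (i.-tuple (kunits k))) :
  gamma_sum n [seq map_tuple (kunits_map f) w | w <- s] = milnorK2_map f (gamma_sum n s).
Proof.
elim: s n => [|w s IHs] [|n]; rewrite ?gamma_sum0 ?[RHS]rmorph1 //.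
  by rewrite !gamma_sum_eq0 // milnorK2_map0.
by rewrite /= !gamma_sum_cons !IHs milnorK2_mapD milnorK2_mapM milnorK2_map_symbol.
Qed.

Lemma gamma_series_natural y : ker_coefs i y ->
  natural_op (fun k ik (x : milnorK2n k i) => gamma_series y ik x).
Proof.
move=> y_ker k l ik il f fE x.
pose s := [seq map_tuple (kunits_map f) w | w <- decomp x].
rewrite (@gamma_seriesE y l il _ s) //; last first.
  rewrite big_map /= [in LHS]decompP (raddf_sum (milnorK2_map f)).
  by apply: eq_bigr => w _; exact: milnorK2_map_symbol.
rewrite /gamma_series (raddf_sum (milnorK2_map f)) size_map; apply: eq_bigr => n _.
by rewrite gamma_sum_map -(milnorK2_map_comp fE) -milnorK2_mapM.
Qed.

Lemma op_gamma_series (phi : operation k0 i) (k : fieldType) (ik : {rmorphism k0 -> k})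
    (x : milnorK2n k i) : phi k ik x = gamma_series (taylor phi) ik x.
Proof. exact: taylor_expansion (decompP x). Qed.

Lemma taylor_ker (phi : operation k0 i) : ker_coefs i (taylor phi).
Proof. by move=> n n2; apply: tau_taylor. Qed.

Lemma gamma_combE (y : {fsfun nat -> milnorK2 k0 with 0}) (k : fieldType)
    (ik : {rmorphism k0 -> k}) (x : milnorK2n k i) :
  gamma_comb y ik x = gamma_series y ik x.
Proof.
rewrite /gamma_comb /gamma_series.
rewrite -(big_mkord xpredT (fun n => milnorK2_map ik (y n) * gamma n x)).
apply: big_uniq_eq; rewrite ?iota_uniq ?fset_uniq //.
  move=> n _; rewrite mem_index_iota /= -leqNgt => xn.
  by rewrite /gamma gamma_sum_eq0 ?mulr0.
by move=> n _ ny; rewrite fsfun_dflt // milnorK2_map0 mul0r.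
Qed.

Lemma homogeneous_symbol (k : fieldType) d (w : seq (kunits k)) :
  size w = d -> symbol w \in @homogeneous k d.
Proof.
by move=> /eqP wd; apply/asboolP; exists [:: Tuple wd]; rewrite big_seq1.
Qed.

Lemma homogeneousD (k : fieldType) d (x x' : milnorK2 k) :
  x \in @homogeneous k d -> x' \in @homogeneous k d -> x + x' \in @homogeneous k d.
Proof.
move=> /asboolP[s ->] /asboolP[s' ->]; apply/asboolP; exists (s ++ s').
by rewrite big_cat.
Qed.

Lemma degree_lt_homogeneous (k : fieldType) D (x : milnorK2 k) :
  degree_lt D.+1 x <-> exists c : forall d : 'I_D.+1, milnorK2n k d, x = \sum_d val (c d).
Proof.
split=> [[s sD ->]|[c ->]]; last first.
  apply: degree_lt_sum => d _; rewrite decompP; apply: degree_lt_sum => w _.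
  by apply: degree_lt_symbol; rewrite size_tuple.
pose x' (d : 'I_D.+1) := \sum_(w <- s | size w == d) symbol w : milnorK2 k.
have x'd d : x' d \in @homogeneous k d.
  rewrite /x'; elim/big_ind: _ => [||w /eqP wd]; last exact: homogeneous_symbol.
    by apply/asboolP; exists [::]; rewrite big_nil.
  exact: homogeneousD.
exists (fun d : 'I_D.+1 => exist (fun x => x \in @homogeneous k d) _ (x'd d)).
rewrite /x' /= (exchange_big_dep xpredT) //= [LHS]big_seq [RHS]big_seq.
apply: eq_bigr => w /(allP sD) wD.
by rewrite (big_pred1 (Ordinal wD)) // => d; rewrite eq_sym.
Qed.

Lemma bounded_degreeP (phi : operation k0 i) : bounded_degree phi <->
  exists D, forall (k : fieldType) (ik : {rmorphism k0 -> k}) x, degree_lt D.+1 (phi k ik x).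
Proof.
by split=> -[D phiD]; exists D => k ik x; apply/degree_lt_homogeneous.
Qed.

Lemma degree_lt_gamma_sum (k : fieldType) n (s : seq (i.-tuple (kunits k))) :
  degree_lt (n * i).+1 (gamma_sum n s).
Proof.
elim: s n => [|w s IHs] [|n]; rewrite ?gamma_sum0; try exact: (@degree_lt_nat _ _ 1).
  by rewrite gamma_sum_eq0 //; exact: degree_lt0.
rewrite gamma_sum_cons; apply: degree_ltD => //.
rewrite mulSn -addnS -{1}(size_tuple w); exact: degree_lt_symbolM.
Qed.

Lemma gamma_comb_bounded (y : {fsfun nat -> milnorK2 k0 with 0}) : exists D,
  forall (k : fieldType) (ik : {rmorphism k0 -> k}) (x : milnorK2n k i),
    degree_lt D.+1 (gamma_comb y ik x).
Proof.
pose d n := projT1 (cid (degree_lt_ex (y n))).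
have dP n : degree_lt (d n) (y n) := projT2 (cid (degree_lt_ex (y n))).
exists (\sum_(n <- finsupp y) (n * i + d n))%N => k ik x.
apply: degree_lt_sum => n yn; rewrite mulrC.
apply: degree_ltW (degree_ltM (degree_lt_gamma_sum n _) (degree_lt_map ik (dP n))).
by rewrite (big_rem n) //= -addnS leq_addr.
Qed.

(** phi'(x) s = phi(x + s) - phi(x) has degree less than D for generic s. *)
Lemma derivative_degree_lt D (phi : operation k0 i) :
  (forall (k : fieldType) (ik : {rmorphism k0 -> k}) x, degree_lt D (phi k ik x)) ->
  forall (k : fieldType) (ik : {rmorphism k0 -> k}) x, degree_lt (D - i) (derivative phi k ik x).
Proof.
move=> phiD k ik x; apply: degree_lt_words => l j w wi.
rewrite -(op_natural (derivative phi) (ik := ik) (il := j \o ik)) //.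
have := derivativeE phi (j \o ik) wi (add_symbolE (milnorK2n_map j x) wi).
set u := phi _ _ _; set v := phi _ _ _ => uv.
rewrite (_ : _ * _ = v + u); last by rewrite uv addrA milnorK2_addxx add0r.
by apply: degree_ltD; exact: phiD.
Qed.

Lemma taylor_degree_lt D (phi : operation k0 i) n :
  (forall (k : fieldType) (ik : {rmorphism k0 -> k}) x, degree_lt D (phi k ik x)) ->
  degree_lt (D - n * i) (taylor phi n).
Proof.
move=> phiD; suff H (k : fieldType) (ik : {rmorphism k0 -> k}) x :
  degree_lt (D - n * i) (iter n (@derivative k0 i) phi k ik x) by exact: H.
elim: n k ik x => [|n IHn] k ik x; first by rewrite subn0; exact: phiD.
by rewrite mulSn addnC subnDA iterS; apply: derivative_degree_lt.
Qed.

Lemma bounded_fsfun (phi : operation k0 i) : bounded_degree phi ->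
  exists y : {fsfun nat -> milnorK2 k0 with 0}, forall n, y n = taylor phi n.
Proof.
case/bounded_degreeP => D phiD.
exists [fsfun n in seq_fset tt (iota 0 D.+1) => taylor phi n] => n.
rewrite fsfun_fun seq_fsetE mem_iota /= add0n; case: ltnP => // Dn.
apply/esym/degree_lt0_eq0; have := taylor_degree_lt n phiD.
by rewrite (eqP (_ : D.+1 - n * i == 0)%N) // subn_eq0 (leq_trans Dn) // leq_pmulr.
Qed.

End GammaSeries.

(** * Operations in degrees 0 and 1, and the theorem *)

Lemma operation_ext (k0 : fieldType) (i : nat) (phi psi : operation k0 i) :
  (forall (k : fieldType) (ik : {rmorphism k0 -> k}) x, phi k ik x = psi k ik x) -> phi = psi.
Proof.
case: phi psi => [f fn] [g gn] /= fg; have fgE : f = g.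
  apply: functional_extensionality_dep => k.
  by apply: functional_extensionality_dep => ik; apply: funext.
by subst g; congr Operation; exact: Prop_irrelevance.
Qed.

Section DegreeZeroOperations.
Variable k0 : fieldType.

Lemma homogeneous_nat (k : fieldType) n : n%:R \in @homogeneous k 0.
Proof.
apply/asboolP; exists (nseq n [tuple]); elim: n => [|n IHn]; first by rewrite big_nil.
by rewrite big_cons -IHn symbol_nil mulrS.
Qed.

(** The inverse of [degree0] on the component of degree 0. *)
Definition of_F2 (k : fieldType) (c : 'F_2) : milnorK2n k 0 :=
  exist (fun x => x \in @homogeneous k 0) _ (homogeneous_nat k c).

Lemma degree0_of_F2 (k : fieldType) c : degree0 (val (of_F2 k c)) = c.
Proof. by rewrite /= (rmorph_nat (@degree0 k)) natr_Zp. Qed.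

Lemma of_F2_degree0 (k : fieldType) (x : milnorK2n k 0) : of_F2 k (degree0 (val x)) = x.
Proof. by apply: val_inj; rewrite [RHS]degree0K. Qed.

Lemma milnorK2n_map_of_F2 (k l : fieldType) (f : {rmorphism k -> l}) c :
  milnorK2n_map f (of_F2 k c) = of_F2 l c.
Proof. by apply: val_inj; rewrite /= rmorph_nat. Qed.

Lemma fun_op_bij : bijective (@fun_op k0).
Proof.
exists (fun phi : operation k0 0 => fun c => phi k0 idfun (of_F2 k0 c)) => [f|phi].
  by apply: funext => c /=; rewrite milnorK2_map_id degree0_of_F2.
apply: operation_ext => k ik x /=.
rewrite -(op_natural phi (ik := idfun) (il := ik)) //.
by rewrite milnorK2n_map_of_F2 of_F2_degree0.
Qed.

Lemma fun_op_linear (a : milnorK2 k0) (f g : 'F_2 -> milnorK2 k0) :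
  fun_op (fun c => a * f c + g c) = op_add (op_scale a (fun_op f)) (fun_op g).
Proof. by apply: operation_ext => k ik x /=; rewrite milnorK2_mapD milnorK2_mapM. Qed.

Lemma fun_op_mul (f g : 'F_2 -> milnorK2 k0) :
  fun_op (fun c => f c * g c) = op_mul (fun_op f) (fun_op g).
Proof. by apply: operation_ext => k ik x /=; rewrite milnorK2_mapM. Qed.

Lemma fun_op_basis : op_basis2 (fun_op (fun c : 'F_2 => (c == 0)%:R : milnorK2 k0))
  (fun_op (fun c : 'F_2 => (c == 1)%:R)).
Proof.
have combE a b : op_add (op_scale a (fun_op (fun c : 'F_2 => (c == 0)%:R)))
    (op_scale b (fun_op (fun c : 'F_2 => (c == 1)%:R))) =
    fun_op (fun c => a * (c == 0)%:R + b * (c == 1)%:R).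
  by apply: operation_ext => k ik x /=; rewrite milnorK2_mapD !milnorK2_mapM.
have [g _ gK] := fun_op_bij.
have fun_op_inj := bij_inj fun_op_bij.
move=> phi; exists (g phi 0, g phi 1); split=> [|[a b]] /=; rewrite combE -{1}(gK phi).
  congr fun_op; apply: funext => -[[|[|//]] c2] /=.
    by rewrite !mulr0 mulr1 addr0; congr (g phi _); apply: val_inj.
  by rewrite !mulr0 mulr1 add0r; congr (g phi _); apply: val_inj.
move/fun_op_inj => gE; congr (_, _); rewrite gE ?eqxx ?mulr1.
  by rewrite eq_sym oner_eq0 mulr0 addr0.
by rewrite oner_eq0 mulr0 add0r.
Qed.

End DegreeZeroOperations.

Lemma ker_coefs_nat (k0 : fieldType) (y : nat -> milnorK2 k0) :
  (forall n, (2 <= n)%N -> y n = 0) -> ker_coefs 1 y.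
Proof. by move=> y0 n /y0 ->; rewrite /tau mulr0. Qed.

Lemma gamma_basis1 (k0 : fieldType) : op_basis2 (op_gamma0 k0 1) (op_gamma1 k0 1).
Proof.
pose y (a b : milnorK2 k0) n := if n is m.+1 then if m is _.+1 then 0 else b else a.
have y_ker a b : ker_coefs 1 (y a b) by apply: ker_coefs_nat => -[|[|n]].
have yE a b (k : fieldType) (ik : {rmorphism k0 -> k}) (x : milnorK2n k 1) :
    gamma_series (y a b) ik x = milnorK2_map ik a * gamma 0 x + milnorK2_map ik b * gamma 1 x.
  rewrite /gamma_series.
  rewrite (@big_ord_support _ (fun n => milnorK2_map ik (y a b n) * gamma n x) _ 2).
  - by rewrite big_ord_recl big_ord1.
  - by move=> n xn; rewrite /gamma gamma_sum_eq0 ?mulr0.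
  - by move=> [|[|n]] //= _; rewrite milnorK2_map0 mul0r.
move=> phi; exists (taylor phi 0, taylor phi 1); split=> [|[a b] phiE].
  apply: operation_ext => k ik x /=; rewrite -yE op_gamma_series.
  congr (gamma_series _ ik x); apply: funext => -[|[|n]] //=.
  by have := @taylor_ker k0 1 isT phi n.+2 isT; rewrite /tau expr0 mul1r.
have E : taylor phi = y a b.
  apply: (@gamma_series_inj k0 1 isT _ _ (@taylor_ker k0 1 isT phi) (y_ker a b)) => k ik x.
  by rewrite -op_gamma_series phiE yE.
by rewrite E.
Qed.

Theorem theorem2 (k0 : fieldType) :
  [/\ [/\ bijective (@fun_op k0),
          forall (a : milnorK2 k0) (f g : 'F_2 -> milnorK2 k0),
            fun_op (fun c => a * f c + g c) =
            op_add (op_scale a (fun_op f)) (fun_op g),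
          forall f g : 'F_2 -> milnorK2 k0,
            fun_op (fun c => f c * g c) = op_mul (fun_op f) (fun_op g)
        & exists e1 e2 : operation k0 0, op_basis2 e1 e2],
      op_basis2 (op_gamma0 k0 1) (op_gamma1 k0 1)
    & forall i : nat, (2 <= i)%N ->
      [/\ (* y * gamma n does not depend on the decomposition into symbols *)
          forall (n : nat) (y : milnorK2 k0), (2 <= n)%N -> tau i y = 0 ->
            forall (k : fieldType) (ik : {rmorphism k0 -> k})
              (x : milnorK2n k i) (s : seq (i.-tuple (kunits k))),
              val x = \sum_(w <- s) symbol w ->
              milnorK2_map ik y * gamma_sum n s = milnorK2_map ik y * gamma n x,
          (* the operations of bounded degree are the direct sum *)
          forall y : {fsfun nat -> milnorK2 k0 with 0}, ker_coefs i y ->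
            exists2 phi : operation k0 i, bounded_degree phi &
              forall (k : fieldType) (ik : {rmorphism k0 -> k})
                (x : milnorK2n k i), phi k ik x = gamma_comb y ik x,
          forall phi : operation k0 i, bounded_degree phi ->
            exists! y : {fsfun nat -> milnorK2 k0 with 0}, ker_coefs i y /\
              forall (k : fieldType) (ik : {rmorphism k0 -> k})
                (x : milnorK2n k i), phi k ik x = gamma_comb y ik x,
          (* all operations are the direct product *)
          forall y : nat -> milnorK2 k0, ker_coefs i y ->
            exists phi : operation k0 i,
              forall (k : fieldType) (ik : {rmorphism k0 -> k})
                (x : milnorK2n k i), phi k ik x = gamma_series y ik x
        & forall phi : operation k0 i,
            exists! y : nat -> milnorK2 k0, ker_coefs i y /\
              forall (k : fieldType) (ik : {rmorphism k0 -> k})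
                (x : milnorK2n k i), phi k ik x = gamma_series y ik x]].
Proof.
split; last move=> i i2.
- split; [exact: fun_op_bij | exact: fun_op_linear | exact: fun_op_mul |].
  by do 2!eexists; exact: fun_op_basis.
- exact: gamma_basis1.
have i_gt0 : (0 < i)%N := ltnW i2.
split.
- move=> n y n2 y_tau k ik x s xs.
  apply: (@coef_gamma_unique _ _ i_gt0 (fun=> y)); first by move=> m _.
  by rewrite -xs decompP.
- move=> y y_ker; exists (Operation (gamma_series_natural i_gt0 y_ker)).
    apply/bounded_degreeP; have [D yD] := gamma_comb_bounded i y.
    by exists D => k ik x; rewrite /= -gamma_combE.
  by move=> k ik x; rewrite gamma_combE.
- move=> phi /(bounded_fsfun i_gt0)[y yE].
  have yE' : y = taylor phi :> (nat -> milnorK2 k0) by apply: funext.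
  exists y; split=> [|z [z_ker phiE]].
    split=> [|k ik x]; first by rewrite yE'; exact: taylor_ker.
    by rewrite gamma_combE yE' op_gamma_series.
  suff zE : taylor phi = z by apply/fsfunP => n; rewrite yE' zE.
  apply: (gamma_series_inj i_gt0 (taylor_ker i_gt0 phi) z_ker) => k ik x.
  by rewrite -op_gamma_series phiE gamma_combE.
- by move=> y y_ker; exists (Operation (gamma_series_natural i_gt0 y_ker)).
move=> phi; exists (taylor phi); split=> [|z [z_ker phiE]].
  split=> [|k ik x]; first exact: taylor_ker.
  exact: op_gamma_series.
apply: (gamma_series_inj i_gt0 (taylor_ker i_gt0 phi) z_ker) => k ik x.
by rewrite -op_gamma_series phiE.
Qed.
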